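(* Let $p$ be a prime, let $g\in\mathbb{F}_p^*$ have multiplicative order $t$, and let $N$ be a positive integer with $N\le t$. Then $$\sum_{\lambda\in\mathbb{F}_p^*}\left|S_{g,p}(\lambda,N)\right|^4\ll p\,N^{71/24+o(1)}\left(1+\left(\frac{N^2}{t}\right)^{1/24}\right)\qquad\text{as }N\to\infty,$$ where $S_{g,p}(\lambda,N)=\sum_{n=1}^{N}e^{2\pi i\lambda g^n/p}$.
   Context: $\mathbb{F}_p$ is the field of $p$ elements, identified with residues modulo $p$, so $e^{2\pi i z/p}$ is well defined for $z\in\mathbb{F}_p$. The notation $f\ll h$ means $f\le Ch$ for some absolute constant $C$. The quantity $o(1)$ tends to $0$ as $N\to\infty$, uniformly in all other parameters. That is, for every $\varepsilon>0$ there is a constant $C(\varepsilon)$, depending only on $\varepsilon$, such that the left side is at most $C(\varepsilon)\,p\,N^{71/24+\varepsilon}\left(1+(N^2/t)^{1/24}\right)$ for all such $p,g,t,N$. *)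

(* Defs.v *)
From HB Require Import structures.
From mathcomp Require Import all_boot all_order all_algebra all_fingroup.
From mathcomp Require Import all_classical all_reals all_analysis.
From mathcomp Require Import complex.

Set Implicit Arguments.
Unset Strict Implicit.
Unset Printing Implicit Defensive.

Import Order.TTheory GRing.Theory Num.Theory.

Local Open Scope ring_scope.
Local Open Scope complex_scope.

(* exp(i x) for real x, by Euler's formula: the libraries have no complex
   exponential on R[i]. *)
Definition expi (R : realType) (x : R) : R[i] := cos x +i* sin x.

(* exp(2 pi i z / p); [z : 'F_p] is read through the coercion to nat, which
   for p prime gives the residue of z in [0, p). *)
Definition addchar (R : realType) (p : nat) (z : 'F_p) : R[i] :=
  expi (2 * pi * (z : nat)%:R / p%:R).

Definition expsum (R : realType) (p : nat) (g lambda : {unit 'F_p})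
    (N : nat) : R[i] :=
  \sum_(1 <= n < N.+1) addchar R (val lambda * val g ^+ n).

(* Main.v *)
(** By orthogonality of characters the sum is at most [p] times the additive
    energy [E] of [A = {g, ..., g ^ N}], so one has to show
    [E ^ 24 * t << (log N) ^ 48 * N ^ 71 * (t + N ^ 2)].

    Take a dyadic level [tau] of the representation function of [A - A] that
    carries [E], and let [Om] be the set of the ratios [a / b] whose difference
    [a - b] lies in that level. If [w] is in [Om] and [z] is a ratio of elements
    of [Om], then [z * (w - 1)] has [tau] representations as a difference of two
    elements of the geometric progression of exponents in [-3N, 3N]; the set
    [Phi] of all such differences has at most [O(E / tau ^ 2)] elements.
    A Balog-Szemeredi-Gowers argument on the multiplicative energy of [Om] then
    gives a large subset [S] of [Om] with [S - S] small, and by Petridis and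
    Ruzsa [2S - 2S] is small as well. As [S] is dense in a geometric
    progression, some [theta = g ^ h] maps many elements of [S] into [S], and
    many products of two elements of a subset [I] of [S] lie in one dilate of
    [S]. Hence the sets of all [(w3 - w4) * u + rho * (w1 - w2) * v], with [rho]
    equal to [1] or [theta], are small. On the other hand some set of this form
    is large: either [theta] moves a point of [R = (I - I) / (I - I)] out of [R],
    or [R] is a union of orbits of [theta] and thus has at least [t / h]
    elements. *)

From mathcomp Require Import all_boot all_order all_algebra all_fingroup.
From mathcomp Require Import zify ring.

Set Implicit Arguments.
Unset Strict Implicit.
Unset Printing Implicit Defensive.

Import Order.TTheory GRing.Theory Num.Theory.


(** * Counting a finite set by the fibres of a map *)

Section Fibres.
Variables (T U : finType) (f : T -> U) (A : {set T}) (B : {set U}).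
Hypothesis fAB : {in A, forall x, f x \in B}.

Lemma card_fibres : #|A| = \sum_(b in B) #|[set a in A | f a == b]|.
Proof.
rewrite -sum1_card (partition_big f (mem B)) //.
apply: eq_bigr => b _; rewrite -sum1_card.
by apply: eq_bigl => a; rewrite inE.
Qed.

Lemma card_fibres_le c k :
  {in B, forall b, c * #|[set a in A | f a == b]| <= k} -> c * #|A| <= #|B| * k.
Proof.
by move=> H; rewrite card_fibres big_distrr -sum_nat_const leq_sum.
Qed.

Lemma card_fibres_ge c k :
  {in B, forall b, k <= c * #|[set a in A | f a == b]|} -> #|B| * k <= c * #|A|.
Proof.
by move=> H; rewrite card_fibres big_distrr -sum_nat_const leq_sum.
Qed.

Lemma popular_fibre :
  0 < #|A| -> exists2 b, b \in B & #|A| <= #|B| * #|[set a in A | f a == b]|.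
Proof.
case/card_gt0P => a0 /fAB Bb0.
have [b Bb bmax] := @arg_maxnP _ (f a0) (mem B)
  (fun b => #|[set a in A | f a == b]|) Bb0.
exists b => //; rewrite -[#|A|]mul1n; apply: card_fibres_le => c Bc.
by rewrite mul1n; apply: bmax.
Qed.

End Fibres.

Lemma leq_card_inj (T U : finType) (f : T -> U) (A : {set T}) (B : {set U}) :
  {in A, forall x, f x \in B} -> {in A &, injective f} -> #|A| <= #|B|.
Proof.
move=> fAB finj; rewrite -(card_in_imset finj); apply: subset_leq_card.
by apply/subsetP => _ /imsetP[x Ax ->]; apply: fAB.
Qed.

(** * Sumsets and difference sets: inequalities of Ruzsa, Petridis and Plunnecke *)

Section SumSets.
Variable V : finZmodType.
Implicit Types A B C X Y : {set V}.
Local Open Scope ring_scope.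

Definition sumset A B := [set x + y | x in A, y in B].
Definition diffset A B := [set x - y | x in A, y in B].

Lemma mem_sumset A B x y : x \in A -> y \in B -> x + y \in sumset A B.
Proof. exact: imset2_f. Qed.

Lemma mem_diffset A B x y : x \in A -> y \in B -> x - y \in diffset A B.
Proof. exact: imset2_f. Qed.

Lemma diffsetS A B C X :
  A \subset B -> C \subset X -> diffset A C \subset diffset B X.
Proof. exact: imset2S. Qed.

Lemma diffset_diffset A B C : diffset (diffset A B) C = diffset A (sumset B C).
Proof.
apply/setP => z; apply/imset2P/imset2P.
  case=> _ c /imset2P[a b Aa Bb ->] Cc ->.
  by exists a (b + c); rewrite ?mem_sumset // opprD addrA.
case=> a _ Aa /imset2P[b c Bb Cc ->] ->.
by exists (a - b) c; rewrite ?mem_diffset // opprD addrA.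
Qed.

Lemma leq_card_diffset A B : (0 < #|B| -> #|A| <= #|diffset A B|)%N.
Proof.
case/card_gt0P => b Bb.
by apply: (@leq_card_inj _ _ (fun a => a - b)) => [a Aa|a a' _ _ /addIr //];
  apply: mem_diffset.
Qed.

(** Fix one representation [b - c] of every difference [x]. Then [(x, a)] goes injectively to
    [(a - b, a - c)], as the two entries differ by [x]. *)
Lemma ruzsa_triangle A B C :
  (#|diffset B C| * #|A| <= #|diffset A B| * #|diffset A C|)%N.
Proof.
pose rep x := odflt (0, 0) [pick q : V * V |
  (q.1 \in B) && (q.2 \in C) && (x == q.1 - q.2)].
have repP x : x \in diffset B C ->
    [/\ (rep x).1 \in B, (rep x).2 \in C & x = (rep x).1 - (rep x).2].
  case/imset2P => b c Bb Cc ->; rewrite /rep.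
  case: pickP => [[u v] /= /andP[/andP[-> ->] /eqP->] //|/(_ (b, c))] /=.
  by rewrite Bb Cc eqxx.
rewrite -!cardsX.
apply: (@leq_card_inj _ _
  (fun q : V * V => (q.2 - (rep q.1).1, q.2 - (rep q.1).2))).
  case=> x a /setXP[/= /repP[? ? _] Aa].
  by rewrite inE /= !mem_diffset.
case=> x a [y b] /setXP[/= /repP[_ _ Ex] _] /setXP[/= /repP[_ _ Ey] _] [E1 E2].
have Exy : x = y.
  have dE (u v w : V) : u - v = (w - v) - (w - u) by rewrite opprB [RHS]addrC subrKA.
  by rewrite Ex Ey (dE _ _ a) E1 E2 -dE.
by congr (_, _) => //; move: E1; rewrite Exy => /addIr.
Qed.

(* [X] minimises the expansion ratio [#|diffset X B| / #|X|] among its subsets. *)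
Definition min_expansion X B := forall Z : {set V}, Z \subset X ->
  (#|diffset X B| * #|Z| <= #|diffset Z B| * #|X|)%N.

Lemma min_expansion_exists A B : (0 < #|A|)%N ->
  exists X, [/\ X \subset A, (0 < #|X|)%N, min_expansion X B
    & (#|diffset X B| * #|A| <= #|diffset A B| * #|X|)%N].
Proof.
move=> A0.
(* minimise the ratio with denominators cleared by [#|A|`!] *)
pose ratio X := (#|diffset X B| * (#|A|`! %/ #|X|))%N.
have P0 : (A \subset A) && (0 < #|A|)%N by rewrite subxx.
case: (arg_minnP (P := fun X : {set V} => (X \subset A) && (0 < #|X|)%N) ratio P0).
move=> X /andP[sXA X0] Xmin.
have cmp (Z : {set V}) : Z \subset A -> (0 < #|Z|)%N ->
    (#|diffset X B| * #|Z| <= #|diffset Z B| * #|X|)%N.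
  move=> sZA Z0.
  have dv (Y : {set V}) : Y \subset A -> (0 < #|Y|)%N ->
      (#|A|`! %/ #|Y| * #|Y| = #|A|`!)%N.
    by move=> sY Y0; rewrite divnK // dvdn_fact // Y0 subset_leq_card.
  pose a := (#|A|`! %/ #|X|)%N; pose b := (#|A|`! %/ #|Z|)%N.
  have le : (#|diffset X B| * a <= #|diffset Z B| * b)%N.
    by apply: Xmin; rewrite sZA.
  have Ea : (a * #|X| = #|A|`!)%N := dv X sXA X0.
  have Eb : (b * #|Z| = #|A|`!)%N := dv Z sZA Z0.
  have : (#|diffset X B| * #|Z| * #|A|`! <= #|diffset Z B| * #|X| * #|A|`!)%N.
    rewrite -{1}Ea -Eb.
    have := leq_mul le (leqnn (#|X| * #|Z|)); nia.
  by rewrite leq_pmul2r ?fact_gt0.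
exists X; split=> //; last exact: cmp.
move=> Z sZX; have [->|Z0] := posnP #|Z|; first by rewrite muln0.
by apply: cmp => //; apply: subset_trans sXA.
Qed.

(* Petridis: induct on [C], a new point [c] costs at most
   [diffset X B] minus the part already covered. *)
Lemma petridis X B C : min_expansion X B ->
  (#|diffset (diffset X C) B| * #|X| <= #|diffset X B| * #|diffset X C|)%N.
Proof.
move=> Xmin; have [n] := ubnP #|C|; elim: n C => // n IHn C leCn.
have [C0|[c Cc]] := set_0Vmem C.
  suff ->: diffset (diffset X C) B = set0 by rewrite cards0.
  apply/setP => z; rewrite inE; apply/negbTE/negP.
  by case/imset2P=> y b /imset2P[x c _]; rewrite C0 inE.
rewrite (cardsD1 c C) Cc ltnS in leCn; have := IHn (C :\ c).
move=> /(_ leCn); set C' := C :\ c; set D := diffset X C' => IH.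
have sD : D \subset diffset X C by apply: diffsetS; rewrite ?subD1set.
(* [X'] collects the [x] for which [c] brings nothing new: [x - c - B] already lies in [D - B].
   Minimality of [X] is finally tested on this set. *)
pose X' := [set x in X | [forall b in B, x - c - b \in diffset D B]].
have sX' : X' \subset X by apply/subsetP => x; rewrite inE => /andP[].
have upper : (#|diffset (diffset X C) B|
    <= #|diffset D B| + #|diffset X B :\: diffset X' B|)%N.
  rewrite -(card_imset (mem (diffset X B :\: _)) (@addIr _ (- c))).
  apply: (leq_trans _ (leq_card_setU _ _).1).
  apply/subset_leq_card/subsetP => z.
  case/imset2P=> _ b /imset2P[x e Xx Ce ->] Bb ->{z}; rewrite inE.
  have [Ee|nec] := eqVneq e c; last first.
    by rewrite mem_diffset // mem_diffset // in_setD1 nec.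
  subst e.
  have [Ix|nIx] := boolP (x - b \in diffset X' B).
    case/imset2P: Ix => x' b'; rewrite inE => /andP[_ /forall_inP H] Bb' E.
    by rewrite addrAC E addrAC H.
  apply/orP; right; apply/imsetP; exists (x - b); last by rewrite addrAC.
  by rewrite in_setD nIx mem_diffset.
have lower : (#|D| + #|X :\: X'| <= #|diffset X C|)%N.
  rewrite -(card_imset (mem (X :\: _)) (@addIr _ (- c))) -cardsUI.
  rewrite (_ : D :&: _ = set0) ?cards0 ?addn0.
    apply/subset_leq_card; rewrite subUset sD; apply/subsetP => z /imsetP[x].
    by rewrite inE => /andP[_ Xx] ->; apply: mem_diffset.
  apply/setP => z; rewrite !inE; apply/negbTE/andP => -[Dz /imsetP[x]].
  rewrite !inE => /andP[nX' Xx] Ez; case/negP: nX'; rewrite Xx.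
  by apply/forall_inP => b Bb; rewrite -Ez mem_diffset.
have sXB : diffset X' B \subset diffset X B by apply: diffsetS.
move: upper lower (Xmin X' sX') (subset_leq_card sXB) (subset_leq_card sX') IH.
by rewrite !cardsDS //; nia.
Qed.

(** A subset [X] of least expansion has [|X - 2A| * |X| <= |X - A| ^ 2] by Petridis. The triangle
    inequality through [X] bounds [2A - 2A], and [|X - A| / |X| <= |A - A| / |A|]. *)
Lemma plunnecke_ruzsa A : (0 < #|A|)%N ->
  (#|diffset (sumset A A) (sumset A A)| * #|A| ^ 3 <= #|diffset A A| ^ 4)%N.
Proof.
move=> A0; have [X [sXA X0 Xmin XA]] := min_expansion_exists A A0.
have := petridis A Xmin; rewrite diffset_diffset.
have := ruzsa_triangle X (sumset A A) (sumset A A).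
move: XA (subset_leq_card sXA).
set a := #|A|; set k := #|X|; set M := #|diffset A A|.
set m := #|diffset X A|; set q := #|diffset X (sumset A A)|.
set Q := #|diffset _ _| => XA ka QX qk.
have Qk3 : (Q * k ^ 3 <= m ^ 4)%N.
  have : (Q * k * k ^ 2 <= (q * k) * (q * k))%N by move: QX; nia.
  have := leq_mul qk qk; nia.
have m4 : (m ^ 4 * a ^ 4 <= M ^ 4 * k ^ 4)%N by rewrite -!expnMn leq_exp2r.
have : (Q * a ^ 4 * k ^ 3 <= M ^ 4 * k * k ^ 3)%N.
  have := leq_mul Qk3 (leqnn (a ^ 4)); nia.
rewrite leq_pmul2r ?expn_gt0 ?X0 // => H.
have : (Q * a ^ 3 * a <= M ^ 4 * a)%N.
  by rewrite -mulnA -expnSr (leq_trans H) // leq_mul2l ka orbT.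
by rewrite leq_pmul2r.
Qed.

End SumSets.

(** * Cauchy-Schwarz, dyadic pigeonholing, subgraphs of large minimum degree *)

Lemma sum_nat_CS (T : finType) (A : {set T}) (f : T -> nat) :
  (\sum_(i in A) f i) ^ 2 <= #|A| * \sum_(i in A) f i ^ 2.
Proof.
rewrite -(@leq_pmul2l 2) // -mulnn big_distrlr /= big_distrr /=.
under eq_bigr do rewrite big_distrr /=.
apply: (@leq_trans (\sum_(i in A) \sum_(j in A) (f i ^ 2 + f j ^ 2))).
  by apply: leq_sum => i _; apply: leq_sum => j _; apply: nat_Cauchy.
under eq_bigr do rewrite big_split /= sum_nat_const.
rewrite big_split /= sum_nat_const -big_distrr /=; lia.
Qed.

(** Split the support of [r] by the truncated binary logarithm of [r x]. On level [i] one has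
    [r x < 2 * 2 ^ i], whence the factor 4; the best level is at least average. *)
Lemma dyadic_level (T : finType) (r : T -> nat) M : (forall x, r x <= M) ->
  exists j, \sum_x r x ^ 2 <=
    4 * (trunc_log 2 M).+1 * (2 ^ j) ^ 2 * #|[set x | 2 ^ j <= r x]|.
Proof.
move=> rM; pose P j := [set x | 2 ^ j <= r x].
pose lev x : 'I_(trunc_log 2 M).+1 := inord (trunc_log 2 (r x)).
have levE x : lev x = trunc_log 2 (r x) :> nat.
  by rewrite inordK // ltnS leq_trunc_log.
case: (arg_maxnP (fun j : 'I_(trunc_log 2 M).+1 => (2 ^ j) ^ 2 * #|P j|)
  (P := xpredT) (i0 := ord0)) => // j _ jmax.
exists j; rewrite (bigID (fun x => r x == 0)) /= big1 => [|x /eqP->//].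
rewrite add0n (partition_big lev xpredT) //=.
apply: (@leq_trans (\sum_(i < (trunc_log 2 M).+1) 4 * ((2 ^ j) ^ 2 * #|P j|))).
  apply: leq_sum => i _; apply: leq_trans (_ : 4 * ((2 ^ i) ^ 2 * #|P i|) <= _).
    rewrite -sum1_card !big_distrr /= big_mkcond [leqRHS]big_mkcond /=.
    apply: leq_sum => x _; rewrite inE -lt0n; case: ifP => // /andP[r0 /eqP iE].
    have := trunc_logP (isT : 1 < 2) r0; have := trunc_log_ltn (r x) (isT : 1 < 2).
    rewrite -levE iE => lt ->; move: lt; rewrite expnS => /ltnW.
    by rewrite muln1 -leq_sqr expnMn.
  by rewrite leq_mul2l; apply: jmax.
by rewrite sum_nat_const card_ord mulnCA !mulnA.
Qed.

(** Delete vertices of degree below [d] one at a time. Each deletion lowers the degree sum by less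
    than [2 * d], so the hypothesis survives and the set never becomes empty. *)
Lemma min_degree (T : finType) (e : rel T) (S : {set T}) d : symmetric e ->
  2 * d * #|S| < \sum_(v in S) #|[set u in S | e v u]| ->
  exists I : {set T}, [/\ I \subset S, 0 < #|I|
    & {in I, forall v, d <= #|[set u in I | e v u]|}].
Proof.
move=> esym; have [n] := ubnP #|S|; elim: n S => // n IHn S leSn big.
have [/forall_inP H|] :=
  boolP [forall v in S, d <= #|[set u in S | e v u]|].
  exists S; split=> //; case: (set_0Vmem S) big => [->|[v Sv] _].
    by rewrite big_set0.
  by rewrite (cardD1 v) Sv.
case/forall_inPn => v Sv; rewrite -ltnNge => ltd.
have SE := cardsD1 v S; rewrite Sv /= in SE.
have {}leSn : #|S :\ v| < n by move: leSn; rewrite SE ltnS.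
have [|I [sI I0 HI]] := IHn _ leSn; last first.
  by exists I; split=> //; apply: subset_trans sI (subD1set _ _).
have degE w : w \in S :\ v ->
    #|[set u in S | e w u]| <= #|[set u in S :\ v | e w u]| + e v w.
  move=> _; rewrite (cardsD1 v) inE Sv esym addnC leq_add2r.
  by apply/subset_leq_card/subsetP => u; rewrite !inE => /andP[-> /andP[-> ->]].
have : \sum_(w in S :\ v) #|[set u in S | e w u]| <=
    \sum_(w in S :\ v) (#|[set u in S :\ v | e w u]| + e v w).
  exact: leq_sum.
rewrite big_split /=.
have : \sum_(w in S :\ v) e v w <= #|[set u in S | e v u]|.
  rewrite -sum1_card big_mkcond [leqRHS]big_mkcond; apply: leq_sum => w _.
  by rewrite !inE; case: (w != v); case: (w \in S); case: (e v w).
by move: big; rewrite (big_setD1 v) //= SE; nia.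
Qed.

(** * Representation function of differences and additive energy *)

Section Rep.
Variable V : finZmodType.
Implicit Types A B C D : {set V}.
Local Open Scope ring_scope.

Definition rep A B (x : V) : nat := (\sum_(a in A) \sum_(b in B) ((a - b)%R == x))%N.

Lemma repE A B x : rep A B x = #|[set q in setX A B | q.1 - q.2 == x]|.
Proof.
rewrite /rep pair_big /= -sum1_card big_mkcond [RHS]big_mkcond /=.
by apply: eq_bigr => -[a b] _; rewrite !inE /=; case: ifP; case: eqP.
Qed.

Lemma sum_rep A B : (\sum_x rep A B x = #|A| * #|B|)%N.
Proof.
under eq_bigr do rewrite repE.
have -> : (\sum_x #|[set q in setX A B | (q.1 - q.2)%R == x]| =
  \sum_(x in [set: V]) #|[set q in setX A B | (q.1 - q.2)%R == x]|)%N.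
  by apply: eq_bigl => x; rewrite inE.
by rewrite -(@card_fibres _ _ (fun q => q.1 - q.2)) ?cardsX // => q; rewrite inE.
Qed.

Lemma rep_leq A B x : (rep A B x <= #|A|)%N.
Proof.
rewrite repE; apply: (@leq_card_inj _ _ fst) => [[a b]|[a b] [c d]].
  by rewrite !inE /= => /andP[/andP[]].
rewrite !inE /= => /andP[_ /eqP E] /andP[_ /eqP E'] ac; subst c; congr (_, _).
by apply: oppr_inj; apply: (addrI a); rewrite E.
Qed.

Lemma rep_inner A B C D : (\sum_x rep A B x * rep C D x =
  \sum_(a in A) \sum_(b in B) \sum_(c in C) \sum_(d in D) ((a - b)%R == (c - d)%R))%N.
Proof.
under eq_bigr => x _ do rewrite /rep big_distrl /=.
rewrite exchange_big; apply: eq_bigr => a _.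
under eq_bigr => x _ do rewrite big_distrl /=.
rewrite exchange_big; apply: eq_bigr => b _.
rewrite (bigD1 (a - b)) //= eqxx mul1n [X in (_ + X)%N]big1 ?addn0.
  by apply: eq_bigr => c _; apply: eq_bigr => d _; rewrite eq_sym.
by move=> x; rewrite eq_sym => /negbTE->.
Qed.

(** The additive energy: the number of quadruples in [A] with [a - b = c - d]. *)
Definition energy A := (\sum_x rep A A x ^ 2)%N.

Lemma energy_gt0 A : (0 < #|A|)%N -> (0 < energy A)%N.
Proof.
case/card_gt0P=> a Aa; rewrite /energy (bigD1 0) //= ltn_addr // expn_gt0 repE orbF.
by apply/card_gt0P; exists (a, a); rewrite !inE /= Aa subrr eqxx.
Qed.

(** As [a - b = c - d] amounts to [a - c = b - d], the sum on the left is the correlation of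
    [rep A A] and [rep B B]; apply [2xy <= x^2 + y^2]. *)
Lemma rep_sq_le A B : (2 * \sum_x rep A B x ^ 2 <= energy A + energy B)%N.
Proof.
have -> : (\sum_x rep A B x ^ 2 = \sum_x rep A A x * rep B B x)%N.
  under eq_bigr do rewrite -mulnn.
  rewrite !rep_inner; apply: eq_bigr => a _; rewrite exchange_big.
  apply: eq_bigr => c _; apply: eq_bigr => b _; apply: eq_bigr => d _.
  by rewrite !subr_eq ![_ - d + _]addrAC [b + c]addrC.
rewrite big_distrr /= -big_split /=; apply: leq_sum => x _.
exact: nat_Cauchy.
Qed.

End Rep.

(** * Energy of unions of dilates, and a Balog-Szemeredi-Gowers argument *)

Section FieldSets.
Variable F : finFieldType.
Implicit Types A S W Om Phi : {set F}.
Local Open Scope ring_scope.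

Lemma energy_dilate (c : F) A : c != 0 -> energy [set c * a | a in A] = energy A.
Proof.
move=> c0; have cI : injective (fun a => c * a) := mulfI c0.
rewrite /energy (reindex_inj cI); apply: eq_bigr => x _; congr (_ ^ 2)%N.
rewrite /rep big_imset /=; last by move=> a b _ _; apply: cI.
apply: eq_bigr => a _; rewrite big_imset /=; last by move=> u v _ _; apply: cI.
by apply: eq_bigr => b _; rewrite -mulrBr (inj_eq cI).
Qed.

(** [rep W W] is at most the sum of the [k ^ 2] mixed representation functions of the dilates.
    Cauchy-Schwarz costs [k ^ 2], and the mixed energies add up to at most [k ^ 2 * energy A]. *)
Lemma energy_cover k (c : 'I_k -> F) A W : (forall i, c i != 0) ->
  (forall w, w \in W -> exists i, exists2 a, a \in A & w = c i * a) ->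
  (energy W <= k ^ 4 * energy A)%N.
Proof.
move=> c0 cov; pose D i := [set c i * a | a in A].
have sum_cov (f : F -> nat) :
    (\sum_(w in W) f w <= \sum_(i < k) \sum_(w in D i) f w)%N.
  rewrite (exchange_big_dep xpredT) //= big_mkcond; apply: leq_sum => w _.
  case: ifP => // /cov[i [a Aa wE]].
  by rewrite (bigD1 i) ?leq_addr //= wE imset_f.
have rep_cov x : (rep W W x <= \sum_(q : 'I_k * 'I_k) rep (D q.1) (D q.2) x)%N.
  rewrite -(pair_bigA _ (fun i j => rep (D i) (D j) x)) /=.
  apply: leq_trans (sum_cov _) _; apply: leq_sum => i _.
  rewrite exchange_big; under [leqRHS]eq_bigr do rewrite /rep exchange_big.
  exact: sum_cov.
rewrite -(@leq_pmul2l 2) //.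
have -> : (2 * (k ^ 4 * energy A) = k ^ 2 *
    \sum_(q : 'I_k * 'I_k) (energy (D q.1) + energy (D q.2)))%N.
  under eq_bigr do rewrite !energy_dilate //.
  by rewrite sum_nat_const card_prod card_ord; nia.
apply: (@leq_trans (2 * \sum_x (k ^ 2 *
    \sum_(q : 'I_k * 'I_k) rep (D q.1) (D q.2) x ^ 2))%N).
  rewrite leq_mul2l; apply: leq_sum => x _.
  apply: (@leq_trans ((\sum_(q : 'I_k * 'I_k) rep (D q.1) (D q.2) x) ^ 2)%N).
    by rewrite leq_sqr.
  have := sum_nat_CS [set: 'I_k * 'I_k] (fun q => rep (D q.1) (D q.2) x).
  rewrite cardsT card_prod card_ord mulnn.
  by under eq_bigl do rewrite inE; under [in leqRHS]eq_bigl do rewrite inE.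
rewrite -big_distrr /= mulnCA leq_mul2l exchange_big big_distrr /=.
by apply/orP; right; apply: leq_sum => q _; apply: rep_sq_le.
Qed.

(* The popularity principle of Balog-Szemeredi-Gowers for the multiplicative
   energy of [Om]: a pair [(m, m')] is good when [m / m'] is a popular ratio.
   Two elements of [S] are joined by many paths [m, m'', m'] of good pairs, and
   every step [m - m'' = m / w * (w - 1) - m'' / w' * (w' - 1)],
   where [m / w = m'' / w'], is a difference of elements of [Phi]. *)
Lemma popular_core Om Phi M : 0 \notin Om ->
  (#|[set x / y | x in Om, y in Om]| <= M)%N ->
  (forall x y w, x \in Om -> y \in Om -> w \in Om -> x / y * (w - 1) \in Phi) ->
  exists S : {set F}, [/\ S \subset Om, (#|Om| <= 2 * #|S|)%N
    & (#|diffset S S| * #|Om| ^ 5 <= 128 * M ^ 2 * #|Phi| ^ 4)%N].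
Proof.
move=> Om0 ZM OmPhi; set n := #|Om|; set Z := imset2 _ _ _ in ZM.
have nz x : x \in Om -> x != 0 by move=> Ox; apply: contraNneq Om0 => <-.
have Zdiv x y : x \in Om -> y \in Om -> x / y \in Z.
  by move=> Ox Oy; apply/imset2P; exists x y.
pose pairs m m' := [set q in setX Om Om | q.1 / q.2 == m / m'].
(* With at most [M] ratios, the average ratio has at least [n ^ 2 / M] pairs. Popular means an
   eighth of this, so at most [n ^ 2 / 8] pairs are bad. *)
pose good m m' := (n ^ 2 <= 8 * M * #|pairs m m'|)%N.
have goodC m m' : good m m' = good m' m.
  rewrite /good; congr (_ <= _ * _)%N.
  have swapI : injective (fun q : F * F => (q.2, q.1)) by move=> [a b] [c d] [-> ->].
  rewrite -(card_imset _ swapI); apply: eq_card => -[a b].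
  rewrite !inE /=; apply/imsetP/idP => [[[u v]]|].
    rewrite !inE /= => /andP[/andP[Ou Ov] /eqP E] [-> ->].
    by rewrite Ou Ov -[v / u]invf_div E invf_div eqxx.
  move=> /andP[/andP[Oa Ob] /eqP E]; exists (b, a); last by [].
  by rewrite !inE /= Oa Ob -[b / a]invf_div E invf_div eqxx.
pose bad := [set q in setX Om Om | ~~ good q.1 q.2].
have badn : (8 * #|bad| <= n ^ 2)%N.
  have [M0|M_gt0] := posnP M.
    have -> : bad = set0; last by rewrite cards0.
    apply/setP => -[a b]; rewrite !inE /=; apply/negbTE/andP => -[/andP[Oa Ob] _].
    move: ZM; rewrite M0 leqn0 cards_eq0 => /eqP/setP/(_ (a / b)).
    by rewrite Zdiv // inE.
  rewrite -(@leq_pmul2l M) // mulnCA mulnA.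
  apply: leq_trans (leq_mul ZM (leqnn _)).
  apply: (@card_fibres_le _ _ (fun q => q.1 / q.2)) => [[a b]|z].
    by rewrite !inE /= => /andP[/andP[Oa Ob] _]; apply: Zdiv.
  case/imset2P=> a b Oa Ob ->.
  have [gab|ngab] := boolP (good a b).
    rewrite [X in #|pred_of_set X|](_ : _ = set0) ?cards0 ?muln0 //.
    apply/setP => -[u v]; rewrite !inE /=; apply/negbTE/andP => -[/andP[_ ng] /eqP E].
    by move: ng; rewrite /good /pairs E -/(pairs a b) -/(good a b) gab.
  rewrite -ltnNge in ngab; apply: leq_trans (ltnW ngab).
  rewrite leq_mul2l; apply/orP; right; apply/subset_leq_card/subsetP => -[u v].
  by rewrite !inE /= => /andP[/andP[/andP[-> ->] _] ->].
pose badof m := [set m' in Om | ~~ good m m'].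
(* By averaging, [S] keeps half of [Om]; two of its elements have at least [n / 2] common good
   partners. *)
pose S := [set m in Om | (4 * #|badof m| <= n)%N].
have sS : S \subset Om by apply/subsetP => m; rewrite inE => /andP[].
exists S; split=> //.
  have := cardsDS sS; rewrite -/n.
  have : (#|Om :\: S| * n <= 4 * #|bad|)%N.
    apply: leq_trans (_ : 4 * #|[set q in bad | q.1 \in Om :\: S]| <= _)%N.
      apply: (@card_fibres_ge _ _ fst) => [q|m]; first by rewrite inE => /andP[].
      move=> mD; have := mD; rewrite in_setD [m \in S]inE => /andP[nS Om_m].
      move: nS; rewrite Om_m /= -ltnNge => /ltnW lt.
      apply: leq_trans lt _; rewrite leq_mul2l; apply/orP; right.
      apply: (@leq_card_inj _ _ (pair m)) => [m' Bm'|a b _ _ [] //].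
      have := Bm'; rewrite [_ \in badof m]inE => /andP[Om_m' ng].
      rewrite inE eqxx andbT inE mD andbT.
      by rewrite !inE /= Om_m Om_m' ng.
    rewrite leq_mul2l; apply/orP; right; apply/subset_leq_card/subsetP => q.
    by rewrite inE => /andP[].
  have := subset_leq_card sS; rewrite -/n; nia.
have nOm m m' : m \in S -> m' \in S ->
    (n <= 2 * #|[set x in Om | good m x && good x m']|)%N.
  rewrite !inE => /andP[_ b1] /andP[_ b2].
  have : (n <= #|[set x in Om | good m x && good x m']|
      + #|badof m :|: badof m'|)%N.
    rewrite /n -(cardsID [set x | good m x && good x m'] Om).
    rewrite leq_add //; apply/subset_leq_card/subsetP => x; rewrite !inE.
      by case/andP=> -> ->.
    by rewrite negb_and (goodC x) => /andP[/orP[->|->] ->]; rewrite ?orbT.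
  have := (leq_card_setU (badof m) (badof m')).1; lia.
pose PP := setX (setX Phi Phi) (setX Phi Phi).
(* Each [m - m'] will get at least [n ^ 5 / (128 * M ^ 2)] preimages under [val]: [n / 2] middle
   points [x], and [n ^ 2 / (8 * M)] choices for each of the two steps. *)
pose val (q : F * F * (F * F)) := q.1.1 - q.1.2 + (q.2.1 - q.2.2).
have cardPP : #|PP| = (#|Phi| ^ 4)%N by rewrite !cardsX; nia.
rewrite -cardPP; apply: leq_trans
  (_ : 128 * M ^ 2 * #|[set q in PP | val q \in diffset S S]| <= _)%N; last first.
  rewrite leq_mul2l; apply/orP; right; apply/subset_leq_card/subsetP => q.
  by rewrite inE => /andP[].
apply: (@card_fibres_ge _ _ val) => [q|z]; first by rewrite inE => /andP[].
case/imset2P=> m m' Sm Sm' ->{z}.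
set fib := [set q in _ | _].
pose G := [set x in Om | good m x && good x m'].
have Om_m := subsetP sS m Sm; have Om_m' := subsetP sS m' Sm'.
have nG : (n <= 2 * #|G|)%N := nOm m m' Sm Sm'.
pose mid (q : F * F * (F * F)) := m - q.1.1 + q.1.2.
suff : (#|G| * n ^ 4 <= 64 * M ^ 2 * #|[set q in fib | mid q \in G]|)%N.
  have : (#|[set q in fib | mid q \in G]| <= #|fib|)%N.
    by apply/subset_leq_card/subsetP => q; rewrite inE => /andP[].
  set u := #|_|; set v := #|fib| => uv H.
  have : (n * n ^ 4 <= 2 * #|G| * n ^ 4)%N by rewrite leq_mul2r nG orbT.
  have : (64 * M ^ 2 * u <= 64 * M ^ 2 * v)%N by rewrite leq_mul2l uv orbT.
  rewrite -expnS; lia.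
apply: (@card_fibres_ge _ _ mid) => [q|x Gx]; first by rewrite inE => /andP[].
have := Gx; rewrite inE => /and3P[Ox g1 g2].
apply: leq_trans (_ : 64 * M ^ 2 * #|setX (pairs m x) (pairs x m')| <= _)%N.
  by rewrite cardsX; have := leq_mul g1 g2; lia.
rewrite leq_mul2l; apply/orP; right.
(* From [a / b = m / x] follows [m / a = x / b], so [m - m / a = m / a * (a - 1)] and
   [x - m / a = x / b * (b - 1)] lie in [Phi]; likewise for the second step. *)
apply: (@leq_card_inj _ _ (fun q : F * F * (F * F) =>
  ((m - m / q.1.1, x - m / q.1.1), (x - x / q.2.1, m' - x / q.2.1)))).
  case=> -[a b] [c d]; rewrite inE /= [_ \in pairs _ _]inE [_ \in pairs _ _]inE /=.
  rewrite !in_setX /= => /andP[/andP[/andP[Oa Ob] /eqP E1] /andP[/andP[Oc Od] /eqP E2]].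
  have step y z u v : y \in Om -> z \in Om -> u \in Om -> v \in Om ->
      u / v = y / z -> (y - y / u \in Phi) /\ (z - y / u \in Phi).
    move=> Oy Oz Ou Ov E; have uy : y / u = z / v.
      apply/eqP; rewrite eqr_div ?nz // eq_sym mulrC -eqr_div ?nz //.
      exact/eqP.
    split; last rewrite uy.
      by have := OmPhi y u u Oy Ou Ou; rewrite mulrBr mulr1 divfK ?nz.
    by have := OmPhi z v v Oz Ov Ov; rewrite mulrBr mulr1 divfK ?nz.
  have [P1 P2] := step _ _ _ _ Om_m Ox Oa Ob E1.
  have [P3 P4] := step _ _ _ _ Ox Om_m' Oc Od E2.
  have valE : val ((m - m / a, x - m / a), (x - x / c, m' - x / c)) = m - m'.
    rewrite /val /=; ring.
  have midE : mid ((m - m / a, x - m / a), (x - x / c, m' - x / c)) = x.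
    rewrite /mid /=; ring.
  rewrite !inE /= P1 P2 P3 P4 valE midE mem_diffset // eqxx /=.
  by move: Gx; rewrite inE => ->; rewrite eqxx.
move=> [[a b] [c d]] [[a' b'] [c' d']] /setXP[/= P1 P2] /setXP[/= P1' P2'].
move: P1 P2 P1' P2'; rewrite !inE /=.
move=> /andP[/andP[Oa Ob] /eqP E1] /andP[/andP[Oc Od] /eqP E2].
move=> /andP[/andP[Oa' Ob'] /eqP E1'] /andP[/andP[Oc' Od'] /eqP E2'].
case=> /addrI/oppr_inj/(mulfI (nz _ Om_m))/invr_inj aa' _.
move=> /addrI/oppr_inj/(mulfI (nz _ Ox))/invr_inj cc' _; subst a' c'.
have ratI y z z' : y \in Om -> y / z = y / z' -> z = z'.
  by move=> Oy /(mulfI (nz _ Oy))/invr_inj.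
congr (_, _, (_, _)).
  by apply: (ratI a) => //; rewrite E1 E1'.
by apply: (ratI c) => //; rewrite E2 E2'.
Qed.

End FieldSets.

(** * Collisions, pencils and the pivot argument *)

Lemma leq_card_image_collisions (T U : finType) (h : T -> U) (P : {set T}) :
  #|P| ^ 2 <= #|h @: P| * #|[set q in setX P P | h q.1 == h q.2]|.
Proof.
have hP : {in P, forall x, h x \in h @: P} by move=> x; apply: imset_f.
(* Cauchy-Schwarz over the fibres of [h], whose squared sizes count the collisions. *)
rewrite {1}(card_fibres hP); apply: leq_trans (sum_nat_CS _ _) _.
rewrite leq_mul2l; apply/orP; right.
rewrite (@card_fibres _ _ (fun q => h q.1) _ (h @: P)) => [|[a b]]; last first.
  by rewrite !inE /= => /andP[/andP[Pa _] _]; apply: imset_f.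
apply: leq_sum => y _; rewrite -mulnn -cardsX.
apply/subset_leq_card/subsetP => -[a b]; rewrite !inE /=.
by case/andP=> /andP[-> /eqP->] /andP[-> /eqP->]; rewrite !eqxx.
Qed.

Lemma unpopular_fibre (T U : finType) (f : T -> U) (A : {set T}) (B : {set U}) :
  {in A, forall x, f x \in B} -> 0 < #|B| ->
  exists2 b, b \in B & #|B| * #|[set a in A | f a == b]| <= #|A|.
Proof.
move=> fAB /card_gt0P[b0 Bb0].
have [b Bb bmin] := @arg_minnP _ b0 (mem B)
  (fun b => #|[set a in A | f a == b]|) Bb0.
exists b => //; rewrite -[#|A|]mul1n; apply: (card_fibres_ge fAB) => c Bc.
by rewrite mul1n; apply: bmin.
Qed.

Section Pivot.
Variable F : finFieldType.
Implicit Types A B C L S I T V W : {set F}.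
Local Open Scope ring_scope.

Definition dilate (c : F) A := [set c * a | a in A].

Lemma leq_card_dilate c A : (#|dilate c A| <= #|A|)%N.
Proof. exact: leq_imset_card. Qed.

Lemma card_dilate c A : c != 0 -> #|dilate c A| = #|A|.
Proof. by move=> c0; apply: card_imset (mulfI c0). Qed.

Lemma diffset_dilate c A B : diffset (dilate c A) (dilate c B) = dilate c (diffset A B).
Proof.
apply/setP => z; apply/imset2P/imsetP.
  by case=> _ _ /imsetP[a Aa ->] /imsetP[b Bb ->] ->; exists (a - b);
    rewrite ?mem_diffset ?mulrBr.
by case=> _ /imset2P[a b Aa Bb ->] ->; exists (c * a) (c * b);
  rewrite ?imset_f ?mulrBr.
Qed.

Lemma sumset_dilate c A B : sumset (dilate c A) (dilate c B) = dilate c (sumset A B).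
Proof.
apply/setP => z; apply/imset2P/imsetP.
  by case=> _ _ /imsetP[a Aa ->] /imsetP[b Bb ->] ->; exists (a + b);
    rewrite ?mem_sumset ?mulrDr.
by case=> _ /imset2P[a b Aa Bb ->] ->; exists (c * a) (c * b);
  rewrite ?imset_f ?mulrDr.
Qed.

Lemma sumsetC A B : sumset A B = sumset B A.
Proof.
by apply/setP => z; apply/imset2P/imset2P => -[a b Aa Bb ->]; exists b a;
  rewrite // addrC.
Qed.

Lemma card_diffsetC A B : #|diffset A B| = #|diffset B A|.
Proof.
have le C D : (#|diffset C D| <= #|diffset D C|)%N.
  apply: (@leq_card_inj _ _ -%R) => [_ /imset2P[c d Cc Dd ->]|x y _ _ /oppr_inj //].
  by rewrite opprB mem_diffset.
by apply/eqP; rewrite eqn_leq !le.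
Qed.

(** The triangle inequality through [c * W], which lies in [L]: exchanging the dilate of [V] for [L]
    costs a factor [|S - S| / d]. *)
Lemma leq_card_diffset_swap A S L V W (c : F) d :
  V \subset S -> W \subset S -> c != 0 -> (d <= #|W|)%N -> dilate c W \subset L ->
  (#|diffset A (dilate c V)| * d <= #|diffset A L| * #|diffset S S|)%N.
Proof.
move=> VS WS c0 dW WL.
apply: leq_trans (_ : #|diffset A (dilate c V)| * #|dilate c W| <= _)%N.
  by rewrite leq_mul2l card_dilate // dW orbT.
apply: leq_trans (ruzsa_triangle _ _ _) _; rewrite card_diffsetC leq_mul //.
  by apply/subset_leq_card/diffsetS.
by rewrite diffset_dilate (leq_trans (leq_card_dilate _ _)) //
  subset_leq_card // diffsetS.
Qed.

Section Pencil.
Variables (S I T : {set F}) (l theta : F) (d : nat).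
Hypotheses (S0 : 0 \notin S) (IS : I \subset S) (TS : T \subset S) (l0 : l != 0).
Hypothesis theta0 : theta != 0.
Hypothesis thetaT : {in T, forall m, theta * m \in S}.

(** Both [w] and [theta * w] multiply [nbr w] into the dilate [l * S], because [theta] maps [T] into
    [S]. *)
Let nbr (w : F) := [set u in I | w * u / l \in T].
Hypothesis deg : {in I, forall w, (d <= #|nbr w|)%N}.

Let pencil (rho w1 w2 w3 w4 : F) :=
  [set (w3 - w4) * q.1 + rho * (w1 - w2) * q.2 | q in setX (nbr w3) (nbr w1)].

(** Expand to [w3 * u + rho * w1 * v - rho * w2 * v - w4 * u]. The first two terms lie in
    [L = l * S]; the other two run over dilates, each exchanged for [L] at cost [|S - S| / d], which
    leaves [2L - 2L]. *)
Lemma leq_card_pencil rho w1 w2 w3 w4 : rho = 1 \/ rho = theta ->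
  w1 \in I -> w2 \in I -> w3 \in I -> w4 \in I ->
  (#|pencil rho w1 w2 w3 w4| * d ^ 2 <=
   #|diffset S S| ^ 2 * #|diffset (sumset S S) (sumset S S)|)%N.
Proof.
move=> rhoE I1 I2 I3 I4.
have rho0 : rho != 0 by case: rhoE => ->; rewrite ?oner_eq0.
have rhoT m : m \in T -> rho * m \in S.
  by case: rhoE => -> Tm; [rewrite mul1r (subsetP TS) | apply: thetaT].
have nz w : w \in I -> w != 0.
  by move=> Iw; apply: contraNneq S0 => <-; apply: (subsetP IS).
have nS w : nbr w \subset S.
  by apply: subset_trans IS; apply/subsetP => u; rewrite inE => /andP[].
pose L := dilate l S.
have nL w u : u \in nbr w -> w * u \in L.
  rewrite inE => /andP[_ Tu]; apply/imsetP; exists (w * u / l).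
    exact: (subsetP TS).
  by rewrite [RHS]mulrC divfK.
have rnL w u : u \in nbr w -> rho * w * u \in L.
  rewrite inE => /andP[_ Tu]; apply/imsetP; exists (rho * (w * u / l)).
    exact: rhoT.
  by rewrite mulrCA [l * _]mulrC divfK // mulrA.
pose X := diffset (sumset L L) (dilate (rho * w2) (nbr w1)).
have sY : pencil rho w1 w2 w3 w4 \subset diffset X (dilate w4 (nbr w3)).
  apply/subsetP => _ /imsetP[[u v] /setXP[/= Hu Hv] ->].
  rewrite (_ : _ + _ = w3 * u + rho * w1 * v - rho * w2 * v - w4 * u); last by ring.
  apply: mem_diffset; last exact: imset_f.
  apply: mem_diffset; last exact: imset_f.
  by apply: mem_sumset; [apply: nL | apply: rnL].
have swap2 : diffset X L =
    diffset (diffset (sumset L L) L) (dilate (rho * w2) (nbr w1)).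
  by rewrite !diffset_diffset sumsetC.
have h1 := @leq_card_diffset_swap X S L (nbr w3) (nbr w4) w4 d
  (nS _) (nS _) (nz _ I4) (deg I4).
have {}h1 : (#|diffset X (dilate w4 (nbr w3))| * d
    <= #|diffset X L| * #|diffset S S|)%N.
  by apply: h1; apply/subsetP => _ /imsetP[u Hu ->]; apply: nL.
have h2 := @leq_card_diffset_swap (diffset (sumset L L) L) S L (nbr w1) (nbr w2)
  (rho * w2) d (nS _) (nS _) (mulf_neq0 rho0 (nz _ I2)) (deg I2).
have {}h2 : (#|diffset X L| * d <=
    #|diffset (sumset S S) (sumset S S)| * #|diffset S S|)%N.
  rewrite swap2; apply: leq_trans (h2 _) _.
    by apply/subsetP => _ /imsetP[u Hu ->]; apply: rnL.
  rewrite leq_mul2r; apply/orP; right.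
  by rewrite diffset_diffset sumset_dilate diffset_dilate leq_card_dilate.
have := subset_leq_card sY; move: h1 h2.
set y := #|pencil _ _ _ _ _|; set x := #|diffset X (dilate _ _)|; set z := #|diffset X L|.
set s2 := #|diffset S S|; set D := #|diffset (sumset S S) _| => h1 h2 yx.
apply: (@leq_trans (x * d * d)); first by rewrite -mulnA mulnn leq_mul2r yx orbT.
apply: (@leq_trans (z * d * s2)).
  by rewrite [leqRHS]mulnAC leq_mul2r h1 orbT.
by rewrite [leqRHS]mulnC -mulnn mulnA leq_mul2r h2 orbT.
Qed.

(* [R = (I - I) / (I - I)]. If [theta] moves some point of [R] outside of [R], that
   point gives a pencil without collisions; otherwise [R] is large and some point
   of [R] gives a pencil with few collisions. *)
Lemma pivot k : (1 < #|I|)%N -> (0 < d)%N ->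
  (forall R : {set F}, 1 \in R -> {in R, forall x, theta * x \in R} -> (k <= #|R|)%N) ->
  let X := (#|diffset S S| ^ 2 * #|diffset (sumset S S) (sumset S S)|)%N in
  (d ^ 4 <= 2 * X)%N \/ (d ^ 6 * k <= 2 * #|I| ^ 4 * X)%N.
Proof.
move=> I1 d0 kR X.
pose Q := [set q in setX (setX I I) (setX I I) | q.2.1 != q.2.2].
pose f (q : F * F * (F * F)) := (q.1.1 - q.1.2) / (q.2.1 - q.2.2).
pose R := f @: Q.
have RP a b c e : a \in I -> b \in I -> c \in I -> e \in I -> c != e ->
    (a - b) / (c - e) \in R.
  move=> Ia Ib Ic Ie ce; apply/imsetP; exists ((a, b), (c, e)) => //.
  by rewrite !inE /= Ia Ib Ic Ie.
have nI w u : u \in nbr w -> u \in I by rewrite inE => /andP[].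
have [/forall_inP closed|] := boolP [forall x in R, theta * x \in R]; last first.
  case/forall_inPn => x /imsetP[[[w1 w2] [w3 w4]]].
  rewrite !inE /= => /andP[/andP[/andP[I_1 I_2] /andP[I_3 I_4]] ne] -> notR; left.
  have nz : w3 - w4 != 0 by rewrite subr_eq0.
  have := leq_card_pencil (or_intror erefl) I_1 I_2 I_3 I_4; rewrite -/X.
  rewrite card_in_imset => [|[u v] [u' v']]; last first.
    move=> /setXP[/= /nI Iu /nI Iv] /setXP[/= /nI Iu' /nI Iv'] E.
    (* A collision would put [theta] times the chosen point into [R]; hence the pencil has at least
       [d ^ 2] elements. *)
    have E' : (w3 - w4) * (u - u') = theta * (w1 - w2) * (v' - v).
      apply/eqP; rewrite -subr_eq0; move/eqP: E; rewrite /= -subr_eq0.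
      by congr (_ == _); ring.
    have [vv'|ne'] := eqVneq v' v.
      rewrite vv' subrr mulr0 in E'; move/eqP: E'; rewrite mulf_eq0 (negbTE nz) /=.
      by rewrite subr_eq0 => /eqP->; rewrite vv'.
    case/negP: notR; have <- : (u - u') / (v' - v) = theta * f (w1, w2, (w3, w4)).
      have nz' : v' - v != 0 by rewrite subr_eq0.
      by apply: (mulfI nz); rewrite mulrA E' mulfK // mulrCA (mulrC (_ - w4)) divfK.
    exact: RP.
  rewrite cardsX => H; apply: (@leq_trans X); last exact: leq_pmull.
  apply: (leq_trans _ H).
  by rewrite (expnD d 2 2) leq_mul2r leq_mul ?deg ?orbT.
have R1 : 1 \in R.
  have /card_gt1P[a [b [Ia Ib ab]]] := I1.
  by rewrite -(@divff _ (a - b)) ?subr_eq0 // RP.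
have kR' := kR R R1 closed.
have fQR : {in Q, forall q, f q \in R} by move=> q; apply: imset_f.
have R_gt0 : (0 < #|R|)%N by apply/card_gt0P; exists 1.
(* The point of [R] with fewest representations has at most [|I| ^ 4 / |R|] of them, and they bound
   the collisions off the diagonal. *)
have [x Rx few] := unpopular_fibre fQR R_gt0.
have {few} : (#|R| * #|[set q in Q | f q == x]| <= #|I| ^ 4)%N.
  apply: leq_trans few _; apply: leq_trans (_ : #|setX (setX I I) (setX I I)| <= _)%N.
    by apply/subset_leq_card/subsetP => q; rewrite inE => /andP[].
  by rewrite !cardsX; lia.
case/imsetP: Rx => -[[w1 w2] [w3 w4]].
rewrite !inE /= => /andP[/andP[/andP[I_1 I_2] /andP[I_3 I_4]] ne] xE few.
have nz : w3 - w4 != 0 by rewrite subr_eq0.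
have := leq_card_pencil (or_introl erefl) I_1 I_2 I_3 I_4; rewrite -/X /pencil.
set P := setX _ _; set h := fun q : F * F => _ => upper.
have lower := leq_card_image_collisions h P.
have coll : (#|[set q in setX P P | h q.1 == h q.2]| <=
    #|P| + #|[set q in Q | f q == x]|)%N.
  rewrite -(cardsID [set q | q.1 == q.2]) leq_add //.
    apply: (@leq_card_inj _ _ fst) => [q|[p p'] [q q']].
      by rewrite !inE => /andP[/andP[/andP[]]].
    rewrite !inE /= => /andP[_ /eqP->] /andP[_ /eqP->] ->//.
  apply: (@leq_card_inj _ _ (fun q : F * F * (F * F) =>
    ((q.1.1, q.2.1), (q.2.2, q.1.2)))); last first.
    by move=> [[a b] [c e]] [[a' b'] [c' e']] _ _ [-> -> -> ->].
  case=> -[u v] [u' v'] /setDP[]; rewrite inE => /andP[/setXP[/= Pp Pp'] /eqP E].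
  rewrite inE /= => nep.
  have /setXP[/= /nI Iu /nI Iv] := Pp; have /setXP[/= /nI Iu' /nI Iv'] := Pp'.
  have E' : (w3 - w4) * (u - u') = (w1 - w2) * (v' - v).
    apply/eqP; rewrite -subr_eq0; move/eqP: E; rewrite /h /= -subr_eq0.
    by congr (_ == _); ring.
  have nev : v' != v.
    apply: contraNneq nep => vv'; rewrite vv' subrr mulr0 in E'.
    move/eqP: E'; rewrite mulf_eq0 (negbTE nz) /= subr_eq0 => /eqP->.
    by rewrite vv'.
  rewrite !inE /= Iu Iu' Iv Iv' nev xE /= /f /=.
  by rewrite eqr_div ?subr_eq0 // mulrC E'.
have p2 : (d ^ 2 <= #|P|)%N by rewrite cardsX leq_mul ?deg.
move: lower coll few upper kR' p2.
set p := #|P|; set c := #|[set q in Q | _]|; set y := #|h @: P|.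
set z := #|[set q in _ | _]|; set r := #|R|; set s := #|I| => H1 H2 H3 H4 H5 H6.
have H7 : (p ^ 2 <= y * (p + c))%N by apply: leq_trans H1 _; rewrite leq_mul2l H2 orbT.
(* If the diagonal dominates, [y >= p / 2]; otherwise [y >= p ^ 2 / (2 * c)] with
   [c <= s ^ 4 / k]. *)
have [cp|pc] := leqP c p.
  left; have p0 : (0 < p)%N by apply: leq_trans H6; rewrite expn_gt0 d0.
  have : (p * p <= 2 * y * p)%N.
    by rewrite mulnn (leq_trans H7) // -mulnA mulnCA leq_mul2l mul2n -addnn
      leq_add2l cp orbT.
  rewrite leq_pmul2r // => H8; rewrite (expnD d 2 2).
  apply: leq_trans (leq_mul H6 (leqnn _)) _.
  by apply: leq_trans (leq_mul H8 (leqnn _)) _; rewrite -mulnA leq_mul2l H4 orbT.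
right; have H8 : (p ^ 2 <= 2 * y * c)%N.
  by rewrite (leq_trans H7) // -mulnA mulnCA leq_mul2l mul2n -addnn
    leq_add2r (ltnW pc) orbT.
have H9 : (p ^ 2 * k <= 2 * y * s ^ 4)%N.
  by apply: leq_trans (leq_mul H8 H5) _; rewrite -mulnA (mulnC c) leq_mul2l H3 orbT.
have H10 : (d ^ 4 <= p ^ 2)%N by rewrite (expnM d 2 2) leq_sqr.
rewrite (expnD d 4 2) mulnAC.
apply: leq_trans (leq_mul (leq_mul H10 (leqnn k)) (leqnn _)) _.
apply: leq_trans (leq_mul H9 (leqnn _)) _.
by rewrite mulnAC -(mulnA 2 y) [leqRHS]mulnAC leq_mul2r leq_mul2l H4 !orbT.
Qed.

End Pencil.
End Pivot.

(** * Geometric progressions and windows of exponents *)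

Section GeometricProgression.
Variables (F : finFieldType) (g : F) (t N : nat).
Local Open Scope ring_scope.

Definition gprog := [set g ^+ (i : nat).+1 | i : 'I_N].
(** Exponents from [-kN] to [kN], shifted by [kN] to stay natural numbers. *)
Definition window k := [set g ^+ (i : nat) / g ^+ (k * N) | i : 'I_(2 * k * N).+1].

Hypotheses (gt : t.-primitive_root g) (N0 : (0 < N)%N) (Nt : (N <= t)%N).

Lemma prim_root_neq0 : g != 0.
Proof.
apply: contra_eq_neq (prim_expr_order gt) => ->.
by rewrite expr0n eqn0Ngt (prim_order_gt0 gt) eq_sym oner_neq0.
Qed.

Let gX0 i : g ^+ i != 0.
Proof. by rewrite expf_neq0 // prim_root_neq0. Qed.

Lemma windowP k x :
  reflect (exists2 i, (i <= 2 * k * N)%N & x = g ^+ i / g ^+ (k * N)) (x \in window k).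
Proof.
apply: (iffP imsetP) => [[i _ ->]|[i ik ->]]; first by exists i; rewrite // -ltnS.
by exists (Ordinal (ik : (i < (2 * k * N).+1)%N)).
Qed.

Lemma card_window k : (0 < k)%N -> (#|window k| <= 3 * k * N)%N.
Proof.
by move=> k0; apply: leq_trans (leq_imset_card _ _) _; rewrite card_ord; nia.
Qed.

Lemma window_neq0 k x : x \in window k -> x != 0.
Proof. by case/windowP=> i _ ->; rewrite mulf_neq0 ?invr_eq0. Qed.

Lemma windowM a b x y : x \in window a -> y \in window b -> x * y \in window (a + b).
Proof.
case/windowP=> i ia -> /windowP[j jb ->]; apply/windowP; exists (i + j)%N; first by lia.
by rewrite mulf_div -!exprD mulnDl.
Qed.

Lemma windowV a x : x \in window a -> x^-1 \in window a.
Proof.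
case/windowP=> i ia ->; apply/windowP; exists (2 * a * N - i)%N; first by lia.
rewrite invf_div; apply/eqP; rewrite eqr_div // -!exprD; apply/eqP; congr (_ ^+ _); lia.
Qed.

Lemma gprog_window a b : a \in gprog -> b \in gprog -> a / b \in window 1.
Proof.
case/imsetP=> i _ -> /imsetP[j _ ->]; apply/windowP; exists (N + i - j)%N.
  by have := ltn_ord i; have := ltn_ord j; lia.
apply/eqP; rewrite eqr_div // -!exprD; apply/eqP; congr (_ ^+ _).
by have := ltn_ord i; have := ltn_ord j; lia.
Qed.

Lemma gprog_neq0 a : a \in gprog -> a != 0.
Proof. by case/imsetP=> i _ ->. Qed.

Lemma gprog_inj : injective (fun i : 'I_N => g ^+ (i : nat).+1).
Proof.
move=> i j /eqP; rewrite (eq_prim_root_expr gt).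
rewrite -addn1 -[(j : nat).+1]addn1 eqn_modDr => /eqP ij; apply: val_inj => /=.
rewrite -(modn_small (leq_trans (ltn_ord i) Nt)) ij.
by rewrite modn_small // (leq_trans (ltn_ord j)).
Qed.

Lemma card_gprog : #|gprog| = N.
Proof. by rewrite card_imset ?card_ord //; apply: gprog_inj. Qed.

(** The shifted exponents run from 0 to [6 * N] inclusive, so blocks of length [N] number seven. The
    successor in the denominator offsets the first exponent 1 of [gprog]. *)
Lemma window3_cover x : x \in window 3 ->
  exists i : 'I_7, exists2 a, a \in gprog & x = g ^+ (i * N) / g ^+ (3 * N).+1 * a.
Proof.
case/windowP=> i i6 ->; have q7 : (i %/ N < 7)%N by rewrite ltn_divLR //; lia.
exists (Ordinal q7); exists (g ^+ (i %% N).+1).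
  by apply/imsetP; exists (Ordinal (ltn_pmod i N0)).
rewrite /= mulrAC -exprD; apply/eqP; rewrite eqr_div // -!exprD; apply/eqP.
by congr (_ ^+ _); rewrite {1}(divn_eq i N); lia.
Qed.

Lemma energy_window3 : (energy (window 3) <= 2401 * energy gprog)%N.
Proof.
apply: (@energy_cover _ 7 (fun i => g ^+ (i * N) / g ^+ (3 * N).+1)).
  by move=> i; rewrite mulf_neq0 ?invr_eq0.
by move=> w /window3_cover.
Qed.

(* Cut the exponents into about [s / 2] blocks; differences with the least
   exponent of the block take few values, hence some value [h] is popular. *)
Lemma shift_overlap (S : {set F}) : S \subset window 1 -> (3 < #|S|)%N ->
  exists h, [/\ (0 < h)%N, (h * #|S| <= 11 * N)%N
    & (#|S| ^ 2 <= 22 * N * #|[set m in S | (g ^+ h * m)%R \in S]|)%N].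
Proof.
set s := #|S| => SW s4.
have s3N : (s <= 3 * N)%N by apply: leq_trans (subset_leq_card SW) (card_window _).
pose idx (m : F) : 'I_(2 * N).+1 :=
  odflt ord0 [pick i : 'I_(2 * N).+1 | m == g ^+ (i : nat) / g ^+ N].
have idxP m : m \in S -> m = g ^+ (idx m : nat) / g ^+ N.
  move/(subsetP SW)/windowP; rewrite muln1 mul1n => -[i iN ->]; rewrite /idx.
  by case: pickP => [j /eqP//|/(_ (Ordinal (iN : i < (2 * N).+1)%N))]; rewrite eqxx.
(* As [H * s > 8 * N], there are at most [s / 2] blocks of length [H]; as [s <= 3 * N], also
   [H * s <= 11 * N]. *)
pose H := ((8 * N) %/ s).+1; pose blk m := (idx m %/ H)%N.
have Hs : (H * s <= 11 * N)%N.
  by rewrite /H mulSn; have := leq_divM (8 * N) s; lia.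
have Hs' : (8 * N < H * s)%N by rewrite /H ltn_ceil // (leq_trans _ s4).
pose lst m := [arg min_(u < m | (u \in S) && (blk u == blk m)) idx u]%N.
have lstP m : m \in S -> [/\ lst m \in S, blk (lst m) = blk m, (idx (lst m) <= idx m)%N
    & forall u, u \in S -> blk u = blk m -> (idx (lst m) <= idx u)%N].
  move=> Sm; rewrite /lst; case: arg_minnP => [|u /andP[Su /eqP bu] umin].
    by rewrite Sm eqxx.
  split=> // [|v Sv bv]; apply: umin; first by rewrite Sm eqxx.
  by rewrite Sv bv eqxx.
pose S' := [set m in S | lst m != m].
have sS' : S' \subset S by apply/subsetP => m; rewrite inE => /andP[].
have half : (s <= 2 * #|S'|)%N.
  suff : (#|S :\: S'| <= ((2 * N) %/ H).+1)%N.
    rewrite cardsDS // -/s; have := leq_divM (2 * N) H.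
    have := subset_leq_card sS'; rewrite -/s.
    move: ((2 * N) %/ H)%N => q; nia.
  rewrite -[leqRHS]card_ord -cardsT.
  apply: (@leq_card_inj _ _ (fun m => inord (blk m) : 'I_((2 * N) %/ H).+1)).
    by move=> m _; rewrite inE.
  move=> u v; rewrite !inE !negb_and !negbK => /andP[+ Su] /andP[+ Sv].
  rewrite Su Sv /= => /eqP lu /eqP lv /(congr1 val) /=.
  have le m : (blk m < ((2 * N) %/ H).+1)%N by rewrite ltnS leq_div2r // -ltnS.
  rewrite !inordK // => buv.
  have [_ _ _ minu] := lstP u Su; have [_ _ _ minv] := lstP v Sv.
  rewrite lu in minu; rewrite lv in minv.
  rewrite (idxP u Su) (idxP v Sv); congr (_ ^+ _ / _).
  by apply/eqP; rewrite eqn_leq minu // minv.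
pose dif m := (idx m - idx (lst m))%N.
have difH m : m \in S' -> (dif m < H)%N.
  rewrite inE => /andP[Sm _]; have [_ bm le _] := lstP m Sm.
  have H0 : (0 < H)%N by [].
  have := ltn_ceil (idx m) H0; have := leq_divM (idx (lst m)) H.
  by rewrite -/(blk _) -/(blk _) bm /dif [((blk m).+1 * H)%N]mulSn; lia.
have S'0 : (0 < #|S'|)%N by lia.
(* Some difference [h] below [H] occurs for at least [|S'| / H] elements. For these
   [m = g ^+ h * lst m], so [lst] injects them into the overlap. *)
have := @popular_fibre _ _ (fun m => inord (dif m) : 'I_H) S' [set: 'I_H]
  (fun _ _ => in_setT _) S'0.
case=> h _; rewrite cardsT card_ord => many.
have fibP m : m \in [set a in S' | inord (dif a) == h] ->
    [/\ m \in S, lst m \in S, lst m != m & (idx m = h + idx (lst m) :> nat)%N].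
  rewrite inE => /andP[S'm /eqP hE]; have := S'm; rewrite inE => /andP[Sm ne].
  have [Sl _ le _] := lstP m Sm; split=> //.
  by rewrite -hE inordK ?difH // /dif subnK.
have key m : m \in [set a in S' | inord (dif a) == h] -> m = g ^+ (h : nat) * lst m.
  move=> /fibP[Sm Sl _ E].
  by rewrite {1}(idxP m Sm) {1}(idxP _ Sl) mulrA -exprD E.
exists h; split.
- have : (0 < #|[set a in S' | inord (dif a) == h]|)%N.
    by move: many S'0; case: #|[set a in _ | _]| => // ; rewrite muln0; lia.
  case/card_gt0P=> m Hm; rewrite lt0n; apply/eqP => h0.
  have [_ _ /eqP[]] := fibP m Hm; by rewrite {2}(key m Hm) h0 expr0 mul1r.
- by apply: leq_trans Hs; rewrite leq_mul2r ltnW ?orbT.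
- have : (#|[set a in S' | inord (dif a) == h]|
      <= #|[set m in S | (g ^+ (h : nat) * m)%R \in S]|)%N.
    apply: (@leq_card_inj _ _ lst) => [m Hm|u v Hu Hv E].
      have [Sm Sl _ _] := fibP m Hm; by rewrite inE Sl -key.
    by rewrite (key u Hu) (key v Hv) E.
  set T := #|[set m in S | _]|; set f := #|_| in many * => fT.
  have : (s <= 2 * (H * T))%N.
    by apply: leq_trans half _; rewrite leq_mul2l (leq_trans many) ?leq_mul.
  move=> sHT; have : (s * s <= 2 * (H * T) * s)%N by rewrite leq_mul2r sHT orbT.
  by have : (H * s * T <= 11 * N * T)%N; [rewrite leq_mul2r Hs orbT|lia].
Qed.

End GeometricProgression.

(** * Popular differences of the progression and the energy dichotomy *)

Section EnergyDichotomy.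
Variables (F : finFieldType) (g : F) (t N : nat).
Local Open Scope ring_scope.
Hypotheses (gt : t.-primitive_root g) (N0 : (0 < N)%N) (Nt : (N <= t)%N).

Let A := gprog g N.
Let win k := window g N k.

(** All powers of [g ^+ h] lie in [R]. Division of [i < t] by [h] encodes [g ^+ i] by an element of
    [R] and a remainder. *)
Lemma leq_order_stable h (R : {set F}) : (0 < h)%N -> 1 \in R ->
  {in R, forall x, g ^+ h * x \in R} -> (t <= h * #|R|)%N.
Proof.
move=> h0 R1 Rc; have RX i : g ^+ (h * i) \in R.
  by elim: i => [|i IH]; rewrite ?muln0 ?expr0 // mulnS exprD Rc.
rewrite -[t]card_ord -[h]card_ord -cardsT -(cardsT 'I_h) mulnC -cardsX.
apply: (@leq_card_inj _ _ (fun i : 'I_t =>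
  (g ^+ (h * (i %/ h)), Ordinal (ltn_pmod i h0)))) => [i _|i j _ _ [E1 E2]].
  by rewrite !inE RX.
apply: val_inj => /=.
have : g ^+ (i : nat) = g ^+ (j : nat).
  by rewrite (divn_eq i h) (divn_eq j h) !(mulnC _ h) !exprD E1 E2.
by move/eqP; rewrite (eq_prim_root_expr gt) !modn_small // => /eqP.
Qed.

(** Let [P] be the differences with at least [tau] representations, where [tau] is the level
    carrying the energy. Then [|P| * tau] is at most [N ^ 2], and at most [N * |Om|] since a ratio
    and its denominator determine a pair. *)
Lemma popular_differences : exists tau (Om Phi : {set F}),
  [/\ Om \subset win 1, (0 < #|Om|)%N,
      (energy A <= 4 * (trunc_log 2 N).+1 * tau * N ^ 2)%N,
      (energy A <= 4 * (trunc_log 2 N).+1 * tau * N * #|Om|)%N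
    & (#|Phi| * tau ^ 2 <= 2401 * energy A)%N] /\
  (forall x y w, x \in Om -> y \in Om -> w \in Om -> x / y * (w - 1) \in Phi).
Proof.
have cA : #|A| = N := card_gprog gt Nt.
have rN x : (rep A A x <= N)%N by rewrite -cA rep_leq.
have [j] := dyadic_level rN; set L := (trunc_log 2 N).+1; set tau := (2 ^ j)%N.
set P := [set x | _] => EP.
have PN : (#|P| * tau <= N ^ 2)%N.
  rewrite -mulnn -cA -sum_rep -sum_nat_const big_mkcond; apply: leq_sum => x _.
  by rewrite inE; case: ifP.
pose pr := [set q in setX A A | q.1 - q.2 \in P].
pose Om := [set q.1 / q.2 | q in pr].
pose Phi := [set x | (tau <= rep (win 3) (win 3) x)%N].
have prA a b : (a, b) \in pr -> a \in A /\ b \in A.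
  by rewrite !inE /= => /andP[/andP[]].
have Ppr : (#|P| * tau <= #|pr|)%N.
  rewrite -[#|pr|]mul1n; apply: (@card_fibres_ge _ _ (fun q => q.1 - q.2)) => [q|x Px].
    by rewrite inE => /andP[].
  rewrite mul1n; have := Px; rewrite inE repE => /leq_trans; apply.
  apply/subset_leq_card/subsetP => q; rewrite !inE => /andP[-> /eqP xE].
  by rewrite xE eqxx andbT; have := Px; rewrite inE.
have prOm : (#|pr| <= #|Om| * N)%N.
  rewrite -[#|pr|]mul1n; apply: (@card_fibres_le _ _ (fun q => q.1 / q.2)) => [q|x _].
    exact: imset_f.
  rewrite mul1n -cA; apply: (@leq_card_inj _ _ snd) => [[a b]|[a b] [c d]].
    by rewrite inE => /andP[/prA[]].
  rewrite inE /= => /andP[/prA[_ Ab] /eqP E] /[!inE] /= /andP[_ /eqP E'] bd; subst d.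
  have b0 := gprog_neq0 gt Ab.
  by congr (_, _); apply: (mulIf (invr_neq0 b0)); rewrite E E'.
have OmW : Om \subset win 1.
  by apply/subsetP => _ /imsetP[[a b] /prA[Aa Ab] ->]; exact: (gprog_window gt N0 Nt).
have {}EP : (energy A <= 4 * L * tau * (#|P| * tau))%N.
  by rewrite (leq_trans EP) // -mulnn mulnA -mulnA [(tau * #|P|)%N]mulnC.
have E1 : (energy A <= 4 * L * tau * N ^ 2)%N.
  by rewrite (leq_trans EP) // leq_mul2l PN orbT.
have E2 : (energy A <= 4 * L * tau * N * #|Om|)%N.
  rewrite (leq_trans EP) // -[leqRHS]mulnA leq_mul2l [(N * _)%N]mulnC.
  by rewrite (leq_trans Ppr prOm) orbT.
exists tau, Om, Phi; split; first split=> //.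
- rewrite lt0n; apply: contraTneq E2 => ->; rewrite muln0 -ltnNge.
  by rewrite energy_gt0 // cA.
- apply: (leq_trans _ (energy_window3 gt N0 Nt)); rewrite -sum_nat_const big_mkcond.
  rewrite /energy; apply: leq_sum => x _; rewrite inE; case: ifP => // ?.
  by rewrite leq_sqr.
move=> x y _ Ox Oy /imsetP[[a b] pab ->] /=; have [Aa Ab] := prA _ _ pab.
have b0 := gprog_neq0 gt Ab; have : a - b \in P by move: pab; rewrite inE => /andP[].
rewrite !inE repE => /leq_trans; apply; rewrite repE.
(* Multiplication by [c] turns representations of [a - b] into ones of [x / y * (a / b - 1)], and
   [c * u = x / y * (u / b)] stays in [win 3]. *)
pose c := x / y / b; have xy2 : x / y \in win 2.
  by apply: (windowM gt N0 Nt (a := 1) (b := 1));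
    rewrite ?(windowV gt N0 Nt) // (subsetP OmW).
have c0 : c != 0.
  by rewrite mulf_neq0 ?invr_eq0 // (window_neq0 gt xy2).
have cW u : u \in A -> c * u \in win 3.
  move=> Au; rewrite /c mulrAC -mulrA; apply: (windowM gt N0 Nt (a := 2)) => //.
  exact: (gprog_window gt N0 Nt).
apply: (@leq_card_inj _ _ (fun q => (c * q.1, c * q.2))) => [[u v]|[u v] [u' v']].
  rewrite !inE /= => /andP[/andP[Au Av] /eqP E]; rewrite !cW // -mulrBr E.
  by apply/eqP; rewrite /c -(mulrA (x / y)) mulrBr mulVf // [_^-1 * a]mulrC.
by move=> _ _ [/(mulfI c0)-> /(mulfI c0)->].
Qed.

(** For the most popular value [l] of [m * j / u] with [u] in [T], join [m] and [j] when [m * j / l]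
    lies in [T]. A subgraph of minimum degree [d] in this dense graph feeds [pivot]. *)
Lemma pivot_subset_window (S : {set F}) : S \subset win 1 ->
  (792 * N ^ 2 < #|S| ^ 3)%N ->
  exists d, (#|S| ^ 3 <= 792 * N ^ 2 * d)%N /\
    ((d ^ 4 * #|S| ^ 3 <= 2 * #|diffset S S| ^ 6)%N \/
     (d ^ 6 * t <= 22 * N * #|diffset S S| ^ 6)%N).
Proof.
set s := #|S| => SW sbig; set sg := #|diffset S S|.
have s4 : (3 < s)%N.
  rewrite ltnNge; apply/negP => s3.
  have : (s ^ 3 <= 3 ^ 3)%N by rewrite leq_exp2r.
  have : (0 < N ^ 2)%N by rewrite expn_gt0 N0.
  by move: sbig; lia.
have s0 : (0 < s)%N by apply: leq_trans s4.
have nz x : x \in S -> x != 0 by move/(subsetP SW)/(window_neq0 gt).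
have S0 : 0 \notin S by apply/negP => /nz; rewrite eqxx.
have [h [h0 hs many]] := shift_overlap gt N0 Nt SW s4.
set T := [set m in S | _] in many.
have TS : T \subset S by apply/subsetP => m; rewrite inE => /andP[].
have thetaT : {in T, forall m, g ^+ h * m \in S} by move=> m; rewrite inE => /andP[].
clearbody T.
pose tri := setX (setX S S) T.
have tri0 : (0 < #|tri|)%N.
  rewrite !cardsX !muln_gt0 -/s s0 /=; move: many; case: #|T| => //.
  by rewrite muln0 leqn0 expn_eq0 eqn0Ngt s0.
have triW : {in tri, forall q, q.1.1 * q.1.2 / q.2 \in win 3}.
  case=> -[m j] u /setXP[/setXP[/= Sm Sj] Tu].
  apply: (windowM gt N0 Nt (a := 2));
    last by rewrite (windowV gt N0 Nt) // (subsetP SW) // (subsetP TS).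
  by apply: (windowM gt N0 Nt (a := 1) (b := 1)); apply: (subsetP SW).
have [l Wl] := popular_fibre triW tri0.
have l0 := window_neq0 gt Wl.
set fib := [set q in tri | _] => pop.
pose adj := [rel m j | m * j / l \in T].
have adjC : symmetric adj by move=> m j; rewrite /= [m * j]mulrC.
pose e := (\sum_(v in S) #|[set u in S | adj v u]|)%N.
have fibE : (#|fib| <= e)%N.
  have -> : e = #|[set q in setX S S | adj q.1 q.2]|.
    rewrite (@card_fibres _ _ fst _ S) => [|q]; last by rewrite !inE => /andP[/andP[]].
    have pairI v : injective (pair v : F -> F * F) by move=> a b [].
    apply: eq_bigr => v Sv; rewrite -(card_imset _ (pairI v)).
    apply: eq_card => -[a b]; rewrite !inE /=; apply/imsetP/idP.
      by case=> u; rewrite inE => /andP[Su ad] [-> ->]; rewrite Sv Su ad eqxx.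
    move=> /andP[/andP[/andP[_ Sb] ad] /eqP av]; subst a; exists b => //.
    by rewrite inE Sb.
  apply: (@leq_card_inj _ _ fst) => [[[m j] u]|[[m j] u] [[m' j'] u']].
    rewrite !inE /= => /andP[/andP[/andP[Sm Sj] Tu] /eqP <-]; rewrite Sm Sj /=.
    by rewrite invf_div mulrC divfK // mulf_neq0 ?nz.
  rewrite inE => /andP[/setXP[/setXP[/= Sm Sj] Tu] /eqP E].
  rewrite inE => /andP[_ /eqP /= E'] [mm jj]; subst m' j'; congr (_, _).
  have mj0 : m * j != 0 by rewrite mulf_neq0 ?nz.
  by apply: invr_inj; apply: (mulfI mj0); rewrite E E'.
(* 198 = 22 * 9: [T] has at least [s ^ 2 / (22 * N)] elements, and [l] is chosen among at most
   [9 * N] values. *)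
have Ne : (s ^ 4 <= 198 * N ^ 2 * e)%N.
  have : (s * s * #|T| <= 9 * N * e)%N.
    move: pop; rewrite !cardsX => /leq_trans; apply.
    by rewrite leq_mul // (card_window gt N0 Nt).
  have := leq_mul many (leqnn (s ^ 2)).
  set k := #|T| => H1 H2; have := leq_mul (leqnn (22 * N)) H2; lia.
have e4 : (4 * s < e)%N.
  have : (792 * N ^ 2 * s < s ^ 3 * s)%N by rewrite ltn_pmul2r.
  rewrite -expnSr => /leq_trans/(_ Ne).
  have -> : (792 * N ^ 2 * s = 198 * N ^ 2 * (4 * s))%N by lia.
  by rewrite ltn_pmul2l // muln_gt0 expn_gt0 N0.
(* The predecessor makes [2 * d * s < e] strict, as [min_degree] asks. From [4 * s < e] follows
   [d > 1], which gives [I] two elements. *)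
pose d := (e.-1 %/ (2 * s))%N.
have s20 : (0 < 2 * s)%N by lia.
have d1 : (1 < d)%N by rewrite /d leq_divRL //; lia.
have de : (2 * d * s < e)%N.
  by have := leq_divM e.-1 (2 * s); rewrite -/d; lia.
have [I [IS I0 deg]] := min_degree adjC de.
have sd : (s ^ 3 <= 792 * N ^ 2 * d)%N.
  have ed : (e <= 4 * s * d)%N.
    by have := ltn_ceil e.-1 s20; rewrite -/d; nia.
  rewrite -(leq_pmul2r s0) -expnSr; apply: leq_trans Ne _.
  have -> : (792 * N ^ 2 * d * s = 198 * N ^ 2 * (4 * s * d))%N by lia.
  by rewrite leq_mul2l ed orbT.
exists d; split=> //.
have theta0 : g ^+ h != 0 by rewrite expf_neq0 // (prim_root_neq0 gt).
have I1 : (1 < #|I|)%N.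
  case/card_gt0P: I0 => w Iw; apply: leq_trans d1 (leq_trans (deg w Iw) _).
  by apply/subset_leq_card/subsetP => u; rewrite inE => /andP[].
pose k := ((t + h).-1 %/ h)%N.
have kt : (t <= h * k)%N.
  by have := ltn_ceil (t + h).-1 h0; rewrite -/k; lia.
have kR (R : {set F}) : 1 \in R -> {in R, forall x, g ^+ h * x \in R} -> (k <= #|R|)%N.
  move=> R1 Rc; have := leq_order_stable h0 R1 Rc => tR.
  by rewrite /k -ltnS ltn_divLR //; lia.
have := pivot S0 IS TS l0 theta0 thetaT deg I1 (ltnW d1) kR.
have := plunnecke_ruzsa s0; rewrite -/sg -/s.
set D := #|_| => DS /= piv.
have XS : (sg ^ 2 * D * s ^ 3 <= sg ^ 6)%N.
  by rewrite -mulnA (expnD sg 2 4) leq_mul2l DS orbT.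
case: piv => H; [left|right].
  apply: leq_trans (leq_mul H (leqnn _)) _.
  by rewrite -mulnA leq_mul2l XS.
have Is : (#|I| ^ 4 <= s ^ 4)%N by rewrite leq_exp2r // subset_leq_card.
have H2 : (d ^ 6 * k * s ^ 3 <= 2 * s * sg ^ 6 * s ^ 3)%N.
  apply: leq_trans (leq_mul H (leqnn _)) _; rewrite -[leqLHS]mulnA.
  apply: leq_trans (leq_mul (leq_mul (leqnn 2) Is) XS) _.
  by rewrite (expnS s 3); lia.
rewrite leq_pmul2r ?expn_gt0 ?s0 // in H2.
apply: leq_trans (leq_mul (leqnn _) kt) _; rewrite [(h * k)%N]mulnC mulnA.
apply: leq_trans (leq_mul H2 (leqnn h)) _.
have -> : (2 * s * sg ^ 6 * h = 2 * (h * s) * sg ^ 6)%N by lia.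
by rewrite leq_mul2r (leq_trans (leq_mul (leqnn 2) hs)) ?orbT // mulnA.
Qed.

(** Here [n], [s], [sg], [Q] are the sizes of [Om], [S], [S - S], [Phi]. Ratios of [Om] lie in a
    window of at most [6 * N] elements, and 4608 = 128 * 6^2. As 6336 = 2^3 * 792, failure of the
    first alternative makes [S] large enough for the pivot. *)
Lemma energy_dichotomy : exists tau n s sg Q,
  [/\ (energy A <= 4 * (trunc_log 2 N).+1 * tau * N ^ 2)%N,
      (energy A <= 4 * (trunc_log 2 N).+1 * tau * N * n)%N,
      (Q * tau ^ 2 <= 2401 * energy A)%N,
      (sg * n ^ 5 <= 4608 * N ^ 2 * Q ^ 4)%N & (n <= 2 * s)%N /\ (s <= sg)%N] /\
  ((n ^ 3 <= 6336 * N ^ 2)%N \/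
   exists d, (s ^ 3 <= 792 * N ^ 2 * d)%N /\
     ((d ^ 4 * s ^ 3 <= 2 * sg ^ 6)%N \/ (d ^ 6 * t <= 22 * N * sg ^ 6)%N)).
Proof.
have [tau [Om [Phi [[OmW Om_gt0 E1 E2 EQ] OmPhi]]]] := popular_differences.
have Om0 : 0 \notin Om.
  by apply/negP => /(subsetP OmW)/(window_neq0 gt); rewrite eqxx.
have ZW : (#|[set (x / y)%R | x in Om, y in Om]| <= 6 * N)%N.
  apply: leq_trans (_ : #|win 2| <= _)%N; last exact: (card_window gt N0 Nt).
  apply/subset_leq_card/subsetP => _ /imset2P[x y Ox Oy ->].
  apply: (windowM gt N0 Nt (a := 1) (b := 1)); first exact: (subsetP OmW).
  by apply: (windowV gt N0 Nt); apply: (subsetP OmW).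
have [S [SOm nS sgQ]] := popular_core Om0 ZW OmPhi.
have S_gt0 : (0 < #|S|)%N by move: Om_gt0 nS; lia.
exists tau, #|Om|, #|S|, #|diffset S S|, #|Phi|; split.
  split=> //; last by rewrite nS leq_card_diffset.
  by apply: leq_trans sgQ _; rewrite expnMn !mulnA.
have [|big] := leqP; [by left|right].
apply: pivot_subset_window; first exact: subset_trans SOm OmW.
have := leq_trans big (_ : #|Om| ^ 3 <= (2 * #|S|) ^ 3)%N.
rewrite leq_exp2r // => /(_ nS).
by rewrite expnMn (_ : 6336 = 2 ^ 3 * 792)%N // -mulnA ltn_pmul2l.
Qed.

End EnergyDichotomy.

(** * Elimination of the auxiliary sizes from the inequalities *)

Section EnergyExponents.
Variables (c E L N tau n s sg Q t : nat).
Hypotheses (c0 : 0 < c) (N0 : 0 < N) (E0 : 0 < E).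
Hypotheses (H1 : E <= c * L * tau * N ^ 2) (H2 : E <= c * L * tau * N * n).
Hypotheses (H3 : Q * tau ^ 2 <= c * E) (H4 : sg * n ^ 5 <= c * N ^ 2 * Q ^ 4).
Hypotheses (H5 : n <= c * s) (H6 : s <= sg).

Let pow k a b : a <= b -> a ^ k <= b ^ k.
Proof. by case: k => // k; rewrite leq_exp2r. Qed.

Let sgn6 : sg ^ 6 * n ^ 30 <= c ^ 6 * N ^ 12 * Q ^ 24.
Proof. by have := pow 6 H4; congr (_ <= _); ring. Qed.

Let Qtau24 : Q ^ 24 * tau ^ 48 <= c ^ 24 * E ^ 24.
Proof. by have := pow 24 H3; congr (_ <= _); ring. Qed.

(** The 45th power of [H2] supplies [tau ^ 45], while [Qtau24] asks for [tau ^ 48]; the missing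
    [tau ^ 3] is paid for by the cube of [H1]. *)
Lemma exponents_45 : n ^ 45 <= c ^ 26 * N ^ 20 * Q ^ 24 ->
  E ^ 24 <= c ^ 98 * L ^ 48 * N ^ 71.
Proof.
move=> n45; have tau0 : 0 < tau by move: E0 H1; case: (tau); rewrite ?muln0 //; lia.
have E21 : E ^ 21 * tau ^ 3 <= c ^ 95 * L ^ 45 * N ^ 65.
  rewrite -(@leq_pmul2r (E ^ 24)) ?expn_gt0 ?E0 //.
  apply: (@leq_trans ((c * L * tau * N * n) ^ 45 * tau ^ 3)).
    by have := leq_mul (pow 45 H2) (leqnn (tau ^ 3)); congr (_ <= _); ring.
  apply: (@leq_trans (c ^ 71 * L ^ 45 * N ^ 65 * (Q ^ 24 * tau ^ 48))).
    by have := leq_mul (leqnn (c ^ 45 * L ^ 45 * N ^ 45 * tau ^ 48)) n45;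
      congr (_ <= _); ring.
  by have := leq_mul (leqnn (c ^ 71 * L ^ 45 * N ^ 65)) Qtau24; congr (_ <= _); ring.
apply: (@leq_trans (E ^ 21 * tau ^ 3 * (c ^ 3 * L ^ 3 * N ^ 6))).
  by have := leq_mul (leqnn (E ^ 21)) (pow 3 H1); congr (_ <= _); ring.
by have := leq_mul E21 (leqnn (c ^ 3 * L ^ 3 * N ^ 6)); congr (_ <= _); ring.
Qed.

(** The 48th power of [H2] contains exactly the [tau ^ 48] that [Qtau24] trades for [E ^ 24]. *)
Lemma exponents_48 : n ^ 48 * t <= c ^ 31 * N ^ 25 * Q ^ 24 ->
  E ^ 24 * t <= c ^ 103 * L ^ 48 * N ^ 73.
Proof.
move=> n48; rewrite -(@leq_pmul2r (E ^ 24)) ?expn_gt0 ?E0 //.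
apply: (@leq_trans ((c * L * tau * N * n) ^ 48 * t)).
  by have := leq_mul (pow 48 H2) (leqnn t); congr (_ <= _); ring.
apply: (@leq_trans (c ^ 79 * L ^ 48 * N ^ 73 * (Q ^ 24 * tau ^ 48))).
  by have := leq_mul (leqnn (c ^ 48 * L ^ 48 * N ^ 48 * tau ^ 48)) n48;
    congr (_ <= _); ring.
by have := leq_mul (leqnn (c ^ 79 * L ^ 48 * N ^ 73)) Qtau24; congr (_ <= _); ring.
Qed.

(** A small [n] and the first alternative for [d] both bound [n ^ 45] and account for the term [t];
    the second alternative bounds [n ^ 48 * t] and accounts for [N ^ 2]. *)
Lemma exponents : n ^ 3 <= c * N ^ 2 \/ (exists d, s ^ 3 <= c * N ^ 2 * d /\
    (d ^ 4 * s ^ 3 <= c * sg ^ 6 \/ d ^ 6 * t <= c * N * sg ^ 6)) ->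
  E ^ 24 * t <= c ^ 103 * L ^ 48 * N ^ 71 * (t + N ^ 2).
Proof.
have cX k : k <= 103 -> c ^ k <= c ^ 103 by move=> ?; apply: leq_pexp2l.
have main45 : n ^ 45 <= c ^ 26 * N ^ 20 * Q ^ 24 ->
    E ^ 24 * t <= c ^ 103 * L ^ 48 * N ^ 71 * (t + N ^ 2).
  move=> /exponents_45 H; apply: leq_mul (leq_addr _ _); apply: leq_trans H _.
  by do 2!apply: leq_mul => //; apply: cX.
case=> [n3|[d [sd [d4|d6]]]].
- apply: main45; apply: (@leq_trans (c ^ 15 * N ^ 18 * Q ^ 24)); last first.
    by do 2!apply: leq_mul => //; apply: leq_pexp2l.
  have n6 : n ^ 6 <= c ^ 2 * N ^ 2 * Q ^ 4.
    apply: (@leq_trans (c * (sg * n ^ 5))).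
      have := leq_mul (leq_trans H5 (leq_mul (leqnn c) H6)) (leqnn (n ^ 5)).
      by congr (_ <= _); ring.
    by have := leq_mul (leqnn c) H4; congr (_ <= _); ring.
  by have := leq_mul (pow 3 n3) (pow 6 n6); congr (_ <= _); ring.
- apply: main45.
  have s15 : s ^ 15 <= c ^ 5 * N ^ 8 * sg ^ 6.
    apply: (@leq_trans (c ^ 4 * N ^ 8 * (d ^ 4 * s ^ 3))).
      by have := leq_mul (pow 4 sd) (leqnn (s ^ 3)); congr (_ <= _); ring.
    by have := leq_mul (leqnn (c ^ 4 * N ^ 8)) d4; congr (_ <= _); ring.
  apply: (@leq_trans (c ^ 15 * s ^ 15 * n ^ 30)).
    by have := leq_mul (pow 15 H5) (leqnn (n ^ 30)); congr (_ <= _); ring.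
  apply: (@leq_trans (c ^ 20 * N ^ 8 * (sg ^ 6 * n ^ 30))).
    by have := leq_mul (leqnn (c ^ 15 * n ^ 30)) s15; congr (_ <= _); ring.
  by have := leq_mul (leqnn (c ^ 20 * N ^ 8)) sgn6; congr (_ <= _); ring.
have s18 : s ^ 18 * t <= c ^ 7 * N ^ 13 * sg ^ 6.
  apply: (@leq_trans (c ^ 6 * N ^ 12 * (d ^ 6 * t))).
    by have := leq_mul (pow 6 sd) (leqnn t); congr (_ <= _); ring.
  by have := leq_mul (leqnn (c ^ 6 * N ^ 12)) d6; congr (_ <= _); ring.
have n48 : n ^ 48 * t <= c ^ 31 * N ^ 25 * Q ^ 24.
  apply: (@leq_trans (c ^ 18 * (s ^ 18 * t) * n ^ 30)).
    by have := leq_mul (pow 18 H5) (leqnn (n ^ 30 * t)); congr (_ <= _); ring.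
  apply: (@leq_trans (c ^ 25 * N ^ 13 * (sg ^ 6 * n ^ 30))).
    by have := leq_mul (leqnn (c ^ 18 * n ^ 30)) s18; congr (_ <= _); ring.
  by have := leq_mul (leqnn (c ^ 25 * N ^ 13)) sgn6; congr (_ <= _); ring.
apply: leq_trans (exponents_48 n48) _.
apply: (@leq_trans (c ^ 103 * L ^ 48 * N ^ 71 * N ^ 2)); last first.
  by rewrite leq_mul // leq_addl.
by apply: eq_leq; ring.
Qed.

End EnergyExponents.

Lemma energy_gprog : exists C, forall (F : finFieldType) (g : F) (t N : nat),
  t.-primitive_root%R g -> 0 < N -> N <= t ->
  energy (gprog g N) ^ 24 * t <=
    C * (trunc_log 2 N).+1 ^ 48 * N ^ 71 * (t + N ^ 2).
Proof.
(* 6336 is the largest constant in [energy_dichotomy], 103 the exponent of [c] in [exponents]. *)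
exists (6336 ^ 103) => F g t N gt N0 Nt.
have [tau [n [s [sg [Q [[H1 H2 H3 H4 [H5 H6]] H7]]]]]] := energy_dichotomy gt N0 Nt.
have E0 : 0 < energy (gprog g N) by rewrite energy_gt0 // (card_gprog gt Nt).
(* hide the constant, lest it be computed in unary *)
have [c cE [c2 c4 c2401 c4608 [c6336 c792 c22]]] : exists2 c, c = 6336 &
    [/\ 2 <= c, 4 <= c, 2401 <= c, 4608 <= c & [/\ 6336 <= c, 792 <= c & 22 <= c]].
  by exists 6336.
rewrite -{}cE.
apply: (exponents (n := n) (s := s) (tau := tau) (sg := sg) (Q := Q)) => //.
- exact: leq_trans c2.
- by apply: leq_trans H1 _; do 3!apply: leq_mul => //.
- by apply: leq_trans H2 _; do 4!apply: leq_mul => //.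
- by apply: leq_trans H3 _; apply: leq_mul.
- by apply: leq_trans H4 _; do 2!apply: leq_mul => //.
- by apply: leq_trans H5 _; apply: leq_mul.
case: H7 => [H7|[d [sd H7]]]; [left|right; exists d; split].
- by apply: leq_trans H7 _; apply: leq_mul.
- by apply: leq_trans sd _; do 2!apply: leq_mul => //.
by case: H7 => H7; [left|right]; apply: leq_trans H7 _; do ?apply: leq_mul => //.
Qed.

Require Import Defs.
From mathcomp Require Import all_classical all_reals all_analysis.
From mathcomp Require Import complex cyclic lra.

Import Order.TTheory GRing.Theory Num.Theory.

Local Open Scope ring_scope.

(** * Additive characters and the fourth moment *)

Section AdditiveCharacter.
Variable R : realType.

Lemma expiD (x y : R) : expi (x + y) = expi x * expi y.
Proof. by rewrite /expi cosD sinD; simpc; rewrite [cos x * sin y + _]addrC. Qed.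

Lemma conjc_expi (x : R) : conjc (expi x) * expi x = 1.
Proof.
rewrite /expi; simpc; rewrite -!expr2 cos2Dsin2.
by congr (_ +i* _)%C; ring.
Qed.

Lemma expi_2pi n : expi (2 * pi * n%:R) = 1 :> R[i].
Proof.
elim: n => [|n IH]; first by rewrite mulr0 /expi cos0 sin0.
by rewrite -[n.+1%:R]natr1 mulrDr mulr1 expiD IH mul1r /expi mulr_natl cos2pi sin2pi.
Qed.

Variables (p : nat) (p_prime : prime p).
Local Notation chi := (@addchar R p).

Let p0 : (0 < p)%N := prime_gt0 p_prime.
Let pR0 : p%:R != 0 :> R. Proof. by rewrite pnatr_eq0 -lt0n. Qed.

(** By periodicity any natural representative may replace the residue; additivity of [addchar] then
    comes from [expiD]. *)
Lemma addchar_nat n : chi n%:R = expi (2 * pi * n%:R / p%:R).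
Proof.
rewrite /addchar val_Fp_nat // {2}(divn_eq n p) natrD natrM.
rewrite -[LHS]mul1r -(expi_2pi (n %/ p)) -expiD; congr expi.
by field.
Qed.

Lemma addcharD x y : chi (x + y) = chi x * chi y.
Proof.
rewrite -[x]natr_Zp -[y]natr_Zp -natrD !addchar_nat -expiD natrD.
by congr expi; field.
Qed.

Lemma addchar0 : chi 0 = 1.
Proof. by have := addchar_nat 0; rewrite mulr0 mul0r => ->; rewrite /expi cos0 sin0. Qed.

Lemma conjc_addchar x : conjc (chi x) = chi (- x).
Proof. by rewrite -[LHS]mulr1 -addchar0 -(subrr x) addcharD mulrA conjc_expi mul1r. Qed.

(** As [p >= 2], the angle [2 * pi / p] lies between 0 and [pi], where the cosine is injective. *)
Lemma addchar1_neq1 : chi 1 != 1.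
Proof.
apply/eqP; have := addchar_nat 1; rewrite mulr1 /expi => -> [+ _].
have p2 : 2 <= p%:R :> R by rewrite ler_nat prime_gt1.
have pi0 : 0 < pi :> R by exact: pi_gt0.
have px0 : 0 < 2 * pi / p%:R :> R by rewrite divr_gt0 ?mulr_gt0 ?ltr0n.
move=> c1; have /cos_inj E : cos (2 * pi / p%:R) = cos 0 :> R by rewrite cos0.
have := px0; rewrite E ?ltxx //.
  by rewrite in_itv /= (ltW px0) /= ler_pdivrMr ?ltr0n // mulrC ler_wpM2l // ltW.
by rewrite in_itv /= lexx ltW.
Qed.

(** For nonzero [x], shifting the variable by 1 multiplies the sum by [chi 1], which is not 1. *)
Lemma sum_addchar (x : 'F_p) :
  \sum_(l : 'F_p) chi (l * x) = if x == 0 then p%:R else 0.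
Proof.
have [->|x0] := eqVneq x 0.
  under eq_bigr do rewrite mulr0 addchar0.
  by rewrite sumr_const cardT -cardE card_Fp.
have <- : \sum_l chi l = \sum_l chi (l * x) by rewrite (reindex_inj (mulIf x0)).
have : \sum_l chi l = \sum_l chi (1 + l) by rewrite (reindex_inj (addrI 1)).
under [X in _ = X]eq_bigr do rewrite addcharD.
rewrite -big_distrr /= => /eqP; rewrite -[X in X == _]mul1r -subr_eq0 -mulrBl.
by rewrite mulf_eq0 subr_eq0 eq_sym (negbTE addchar1_neq1) => /eqP.
Qed.

Lemma sum_addchar_rep (A : {set 'F_p}) l :
  (\sum_(a in A) chi (l * a)) * conjc (\sum_(a in A) chi (l * a)) =
  \sum_x (rep A A x)%:R * chi (l * x).
Proof.
rewrite rmorph_sum /= big_distrlr /=.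
under [RHS]eq_bigr => x _.
  rewrite /rep natr_sum big_distrl /=.
  under eq_bigr do rewrite natr_sum big_distrl /=.
  over.
rewrite [RHS]exchange_big; apply: eq_bigr => a _ /=.
rewrite [RHS]exchange_big; apply: eq_bigr => b _ /=.
rewrite (bigD1 (a - b)) //= eqxx mul1r big1 ?addr0 => [|x]; last first.
  by rewrite eq_sym => /negbTE->; rewrite mul0r.
by rewrite mulrBr addcharD -conjc_addchar.
Qed.

Lemma fourth_moment (A : {set 'F_p}) :
  \sum_(l : 'F_p) ComplexField.Normc.normc (\sum_(a in A) chi (l * a)) ^+ 4 =
  p%:R * (energy A)%:R.
Proof.
have normE (z : R[i]) :
    real_complex R (ComplexField.Normc.normc z ^+ 2) = z * conjc z.
  by rewrite rmorphXn; apply: sqr_normc.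
have conjM (z : R[i]) : conjc (z * conjc z) = z * conjc z.
  by rewrite rmorphM /= conjcK mulrC.
apply: (@complexI R); rewrite rmorph_sum /= rmorphM /= !rmorph_nat.
under eq_bigr => l _.
  rewrite (exprM _ 2 2) rmorphXn /= normE.
  (* The squared modulus is real, so one of its two copies may be conjugated. The product then
     carries [chi (l * (x - y))], and orthogonality in [l] leaves [y = x]. *)
  have conjS : \sum_x (rep A A x)%:R * chi (l * x) =
      \sum_x (rep A A x)%:R * chi (- (l * x)).
    rewrite -sum_addchar_rep -conjM sum_addchar_rep.
    rewrite rmorph_sum; apply: eq_bigr => x _.
    rewrite rmorphM; congr (_ * _); first exact: conjc_nat.
    exact: conjc_addchar.
  rewrite sum_addchar_rep expr2 {2}conjS big_distrlr.
  over.
rewrite exchange_big /energy natr_sum big_distrr /=; apply: eq_bigr => x _.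
rewrite exchange_big (bigD1 x) //= [X in _ + X]big1 ?addr0 => [|y yx].
  under eq_bigr do rewrite mulrACA -addcharD subrr addchar0.
  by rewrite sumr_const cardT -cardE card_Fp // !mulr1 -[LHS]mulr_natl natrX expr2.
under eq_bigr do rewrite mulrACA -addcharD -mulrBr.
by rewrite -big_distrr /= sum_addchar subr_eq0 eq_sym (negbTE yx) mulr0.
Qed.

End AdditiveCharacter.

(** * From the energy bound to the exponential sum *)

Lemma primitive_root_unit (F : finFieldType) (g : {unit F}) :
  #[g]%g.-primitive_root (val g).
Proof.
apply/andP; split; first exact: order_gt0.
apply/forallP => i; rewrite unity_rootE -FinRing.val_unitX.
rewrite -[1](FinRing.val_unit1 F) (inj_eq val_inj) -order_dvdn.
apply/eqP; apply/idP/eqP => [/dvdn_leq le|->//].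
by apply/eqP; rewrite eqn_leq ltn_ord le.
Qed.

(** Adding the nonnegative term at 0 completes the sum to the whole field, where orthogonality
    applies. *)
Lemma sum_unit_le (R : realType) (F : finFieldType) (f : F -> R) :
  (forall x, 0 <= f x) -> \sum_(u : {unit F}) f (val u) <= \sum_x f x.
Proof.
move=> f0; pose D := [set val u | u in [set: {unit F}]].
have -> : \sum_(u : {unit F}) f (val u) = \sum_(x in D) f x.
  rewrite big_imset => [|u v _ _]; last exact: val_inj.
  by apply: eq_bigl => u; rewrite inE.
rewrite [leRHS](bigID (mem D)) /= lerDl.
by apply: sumr_ge0.
Qed.

Lemma expsumE (R : realType) (p : nat) (g l : {unit 'F_p}) t N :
  t.-primitive_root (val g) -> (N <= t)%N ->
  expsum R g l N = \sum_(a in gprog (val g) N) addchar R (val l * a).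
Proof.
move=> gt Nt; rewrite big_imset /=; last by move=> i j _ _; apply: (gprog_inj gt Nt).
by rewrite /expsum big_add1 big_mkord.
Qed.

(** This absorbs logarithms into [N ^ o(1)], by [1 + d * ln N <= exp (d * ln N)]. *)
Lemma trunc_log_powR (R : realType) (d : R) : 0 < d -> exists2 K, 0 < K &
  forall N, (0 < N)%N -> ((trunc_log 2 N).+1)%:R <= K * N%:R `^ d.
Proof.
move=> d0; have ln2 : 0 < ln 2 :> R by rewrite ln_gt0 // ltr1n.
have dl : 0 < d * ln 2 by rewrite mulr_gt0.
exists (1 + (d * ln 2)^-1); first by rewrite addr_gt0 ?invr_gt0.
move=> N N0; set l := trunc_log 2 N.
have l2 : l%:R * ln 2 <= ln N%:R :> R.
  have lN : (2 ^ l <= N)%N := trunc_logP (isT : (1 < 2)%N) N0.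
  have -> : l%:R * ln 2 = ln (2 ^ l)%:R :> R by rewrite natrX lnXn // mulr_natl.
  by rewrite ler_ln ?posrE ?ltr0n ?expn_gt0 // ler_nat.
have Nd : 1 + d * ln N%:R <= N%:R `^ d.
  by rewrite /powR gt_eqF ?ltr0n //; apply: expR_ge1Dx.
apply: (@le_trans _ _ ((1 + (d * ln 2)^-1) * (1 + d * (l%:R * ln 2)))).
  rewrite -natr1 mulrDl mul1r mulrDr mulr1 [_^-1 * _]mulrC.
  rewrite [d * (_ * _)]mulrCA mulfK ?gt_eqF //.
  by have : 0 <= (d * ln 2)^-1; [rewrite invr_ge0 ltW|];
    have := mulr_ge0 (ler0n R l) (ltW dl); lra.
rewrite ler_wpM2l ?addr_ge0 ?invr_ge0 ?(ltW dl) //.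
by apply: le_trans Nd; rewrite lerD2l ler_pM2l.
Qed.

(** Plays the part of subadditivity of the 24th root in the final estimate. *)
Lemma exprD_ge (R : realType) (y : R) n : 0 <= y -> 1 + y ^+ n.+1 <= (1 + y) ^+ n.+1.
Proof.
move=> y0; elim: n => [|n IH]; first by rewrite !expr1.
have yn := exprn_ge0 n.+1 y0; rewrite [leRHS]exprS.
apply: (@le_trans _ _ ((1 + y) * (1 + y ^+ n.+1))).
  by rewrite [y ^+ n.+2]exprS; nra.
by rewrite ler_wpM2l // addr_ge0.
Qed.

Theorem theorem1 (R : realType) :
  forall eps : R, 0 < eps ->
  exists C : R,
  forall (p : nat) (g : {unit 'F_p}) (t N : nat),
    prime p -> #[g]%g = t -> (0 < N)%N -> (N <= t)%N ->
    \sum_(lambda : {unit 'F_p})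
        ComplexField.Normc.normc (expsum R g lambda N) ^+ 4
    <= C * p%:R * (N%:R `^ (71 / 24 + eps))
         * (1 + (N%:R ^+ 2 / t%:R) `^ (1 / 24)).
Proof.
move=> eps eps0; have e2 : 0 < eps / 2 by rewrite divr_gt0.
have [C0 HC] := energy_gprog; have [K K0 HK] := trunc_log_powR e2.
(* The 24th root turns the factor [L ^ 48] of the energy bound into [L ^ 2], hence [K ^ 2] and the
   use of [eps / 2]. With 1 added, the 24th power of the constant is at least [C0]. *)
exists ((C0%:R + 1) * K ^+ 2) => p g t N p_prime gt N0 Nt.
have prim : t.-primitive_root (val g) by rewrite -gt; apply: primitive_root_unit.
have {}HC := HC _ _ _ _ prim N0 Nt; set E := energy _ in HC.
have t0 : (0 < t)%N := leq_trans N0 Nt.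
have NR0 : 0 < N%:R :> R by rewrite ltr0n.
have tR0 : 0 < t%:R :> R by rewrite ltr0n.
apply: (@le_trans _ _ (p%:R * E%:R)).
  rewrite -fourth_moment //.
  apply: le_trans (@sum_unit_le R _ (fun l => ComplexField.Normc.normc
    (\sum_(a in gprog (val g) N) addchar R (l * a)) ^+ 4) _).
    by apply: ler_sum => l _; rewrite (expsumE R l prim Nt).
  by move=> x; rewrite (exprM _ 2 2) sqr_ge0.
set y : R := (N%:R ^+ 2 / t%:R) `^ (1 / 24); set W := N%:R `^ (71 / 24 + eps).
rewrite (_ : _ * W * (1 + y) =
  p%:R * ((C0%:R + 1) * K ^+ 2 * W * (1 + y))); last by ring.
rewrite ler_wpM2l // {}/W.
have y0 : 0 <= y := powR_ge0 _ _.
have y24 : y ^+ 24 = N%:R ^+ 2 / t%:R.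
  by rewrite -powR_mulrn // -powRrM mul1r mulVf ?pnatr_eq0 // powRr1.
set L := (trunc_log 2 N).+1 in HC.
pose B := (C0%:R + 1) * L%:R ^+ 2 * N%:R `^ (71 / 24) * (1 + y).
apply: (@le_trans _ _ B); last first.
  have Neps : N%:R `^ (71 / 24 + eps) =
      N%:R `^ (71 / 24) * (N%:R `^ (eps / 2)) ^+ 2 :> R.
    rewrite powRD; last by rewrite (gt_eqF NR0) implybT.
    congr (_ * _); rewrite expr2 -powRD; last by rewrite (gt_eqF NR0) implybT.
    by rewrite -splitr.
  have LK : L%:R ^+ 2 <= (K * N%:R `^ (eps / 2)) ^+ 2.
    by rewrite lerXn2r ?nnegrE ?mulr_ge0 ?powR_ge0 ?(ltW K0) // HK.
  rewrite Neps /B; apply: ler_wpM2r; first by rewrite addr_ge0.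
  rewrite [leRHS](_ : _ = (C0%:R + 1) * (K * N%:R `^ (eps / 2)) ^+ 2 * N%:R `^ (71 / 24)).
    apply: ler_wpM2r; first exact: powR_ge0.
    by apply: ler_wpM2l => //; rewrite addr_ge0.
  by ring.
have B0 : 0 <= B by rewrite !mulr_ge0 ?powR_ge0 ?addr_ge0 ?exprn_ge0.
rewrite -(@ler_pXn2r R 24) ?nnegrE //.
have N71 : (N%:R `^ (71 / 24)) ^+ 24 = N%:R ^+ 71 :> R.
  rewrite -powR_mulrn ?powR_ge0 // -powRrM divfK ?pnatr_eq0 // powR_mulrn //.
have B24 : B ^+ 24 = (C0%:R + 1) ^+ 24 * L%:R ^+ 48 * N%:R ^+ 71 * (1 + y) ^+ 24.
  by rewrite -N71 /B; ring.
rewrite -(ler_pM2r tR0) B24.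
apply: (@le_trans _ _ (C0%:R * L%:R ^+ 48 * N%:R ^+ 71 * (t%:R + N%:R ^+ 2))).
  by rewrite -!natrX -natrD -!natrM ler_nat.
have -> : t%:R + N%:R ^+ 2 = (1 + y ^+ 24) * t%:R :> R.
  by rewrite y24 mulrDl mul1r divfK // gt_eqF.
rewrite mulrA; apply: ler_wpM2r; first exact: ltW.
have LN0 : 0 <= L%:R ^+ 48 * N%:R ^+ 71 :> R by rewrite mulr_ge0 ?exprn_ge0.
apply: ler_pM; last exact: exprD_ge.
- by rewrite -mulrA mulr_ge0.
- by rewrite addr_ge0 ?exprn_ge0.
rewrite -(mulrA C0%:R) -(mulrA (_ ^+ 24)); apply: ler_wpM2r => //.
apply: (@le_trans _ _ (C0%:R + 1)); first by rewrite lerDl.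
by rewrite ler_eXnr // lerDr.
Qed.
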